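(* Suppose that $G$ satisfies: (i) there is $0<\alpha<1$ such that for $m$-almost every $\underline{x}\in\Sigma_A^+$ one has $d(G(\underline{x},y_1),G(\underline{x},y_2))\le \alpha\, d(y_1,y_2)$ for all $y_1,y_2\in K$; (ii) for every $y\in K$ there is $k_y\ge0$ with $d(G(\underline{x}^1,y),G(\underline{x}^2,y))\le k_y\,d_\theta(\underline{x}^1,\underline{x}^2)$ for all $\underline{x}^1,\underline{x}^2\in\Sigma_A^+$, and $\sup_{y\in K}k_y<\infty$. Let $\mu_0$ be the unique $F$-invariant probability measure in $S^\infty$. Then $\widehat{\mathcal{F}}(\Sigma)\subset\Theta_{\mu_0}$; that is, $f\mu_0\in S^\infty$ for every function $f:\Sigma\to\mathbb{R}$ that is Lipschitz with respect to $d_\theta+d$.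
   Context: Base. Let $A$ be an aperiodic $N\times N$ matrix with entries in $\{0,1\}$ (some power of $A$ has all entries positive), $\Sigma_A^+=\{\underline{x}=(x_i)_{i\ge 0}: x_i\in\{1,\dots,N\},\ A_{x_ix_{i+1}}=1\ \forall i\}$, with the metric $d_\theta(\underline{x},\underline{y})=\sum_{i\ge0}\theta^i(1-\delta(x_i,y_i))$, where $\theta\in(0,1)$ is fixed and $\delta(a,b)=1$ if $a=b$, $0$ otherwise. Let $\sigma$ be the left shift and $m$ a Markov measure associated to $(\Sigma_A^+,\sigma)$ (the $\sigma$-invariant probability given by a stochastic matrix $(p_{ij})$ with $p_{ij}>0$ iff $A_{ij}=1$ and its stationary probability vector). For $\varphi:\Sigma_A^+\to\mathbb{R}$ let $|\varphi|_\theta$ be its Lipschitz constant with respect to $d_\theta$ and $\mathcal{F}_\theta(\Sigma_A^+)=\{\varphi:|\varphi|_\theta<\infty\}$. Skew product. $(K,d)$ is a compact metric space with $\operatorname{diam}(K)=1$; $\Sigma:=\Sigma_A^+\times K$; $G:\Sigma\to K$ is measurable (Borel) and $F(\underline{x},y)=(\sigma(\underline{x}),G(\underline{x},y))$. Put $\gamma_{\underline{x}}=\{\underline{x}\}\times K$, $\pi_1(\underline{x},y)=\underline{x}$, $\pi_2(\underline{x},y)=y$; $\pi_1^*$ denotes push-forward. $\widehat{\mathcal{F}}(\Sigma)$ is the set of real functions on $\Sigma$ that are Lipschitz with respect to $d_\theta+d$. Spaces of measures. For a finite signed Borel measure $\nu$ on a compact metric space $X$, $\|\nu\|_W=\sup\{|\int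 g\,d\nu| : g:X\to\mathbb{R}\text{ Lipschitz with constant}\le1,\ \|g\|_\infty\le1\}$. Let $\mathcal{AB}$ be the set of finite signed Borel measures $\mu$ on $\Sigma$, with Jordan decomposition $\mu=\mu^+-\mu^-$, such that $\pi_1^*\mu^+\ll m$ and $\pi_1^*\mu^-\ll m$; write $\phi_1=\frac{d(\pi_1^*\mu)}{dm}$. For positive $\mu\in\mathcal{AB}$ let $\{\mu_{\gamma_{\underline{x}}}\}$ be its Rokhlin disintegration along the leaves: probabilities on $\Sigma$ with $\mu_{\gamma_{\underline{x}}}(\gamma_{\underline{x}})=1$ for $\phi_1m$-a.e. $\underline{x}$, $\underline{x}\mapsto\mu_{\gamma_{\underline{x}}}(E)$ measurable, and $\mu(E)=\int\mu_{\gamma_{\underline{x}}}(E)\phi_1(\underline{x})\,dm(\underline{x})$ for all measurable $E\subset\Sigma$. The restriction of positive $\mu$ to $\gamma_{\underline{x}}$ is the positive measure on $K$ given by $\mu|_{\gamma_{\underline{x}}}(B)=\phi_1(\underline{x})\,\mu_{\gamma_{\underline{x}}}(\pi_2^{-1}(B))$ (zero where $\phi_1(\underline{x})=0$); for signed $\mu\in\mathcal{AB}$, $\mu|_{\gamma_{\underline{x}}}:=\mu^+|_{\gamma_{\underline{x}}}-\mu^-|_{\gamma_{\underline{x}}}$. Set $\|\mu\|_\infty=\operatorname{ess\,sup}_{\underline{x}}\|\mu|_{\gamma_{\underline{x}}}\|_W$ (with respect to $m$), $\mathcal{L}^\infty=\{\mu\in\mathcal{AB}:\|\mu\|_\infty<\infty\}$,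 $S^\infty=\{\mu\in\mathcal{L}^\infty:\phi_1\in\mathcal{F}_\theta(\Sigma_A^+)\}$. Under (i) there is a unique $F$-invariant probability measure $\mu_0\in S^\infty$. For a $\mu_0$-integrable $f$, $f\mu_0(E)=\int_Ef\,d\mu_0$, and $\Theta_{\mu_0}=\{f:\Sigma\to\mathbb{R}:f\mu_0\in S^\infty\}$. *)

(* Defs.v *)
From HB Require Import structures.
From mathcomp Require Import all_boot all_order all_algebra.
From mathcomp Require Import all_classical all_reals all_analysis.
From mathcomp Require Import measurable_realfun ess_sup_inf.

Set Implicit Arguments.
Unset Strict Implicit.
Unset Printing Implicit Defensive.

Import Order.TTheory GRing.Theory Num.Theory.
Import numFieldNormedType.Exports.

Local Open Scope classical_set_scope.
Local Open Scope ring_scope.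

(* [measurableType] requires a base point; the metric spaces considered below
   are all nonempty. *)
#[short(type="pmetricType")]
HB.structure Definition PointedMetric (R : numDomainType) :=
  { M of Metric R M & Pointed M }.

Definition borel (T : ptopologicalType) := g_sigma_algebraType (@open T).

(* The canonical product sigma-algebra on [borel X * borel K] is the Borel
   sigma-algebra of the product space; compact spaces qualify by
   [compact_second_countable]. *)
Lemma measurable_borel_prod (R : realType) (X K : pmetricType R) :
  @second_countable X -> @second_countable K ->
  (measurable : set (set (borel X * borel K))) = <<s @open (X * K)%type >>.
Proof.
move=> [BX cX [oX bX]] [BK cK [oK bK]]; apply/seteqP; split.
  apply: smallest_sub; first exact: smallest_sigma_algebra.
  have mf : @measurable_fun _ _ (g_sigma_algebraType (@open (X * K)%type))
      (borel X) setT fst.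
    apply: (@measurability _ _ (g_sigma_algebraType (@open (X * K)%type))
      (borel X) setT fst (@open X)) => // _ [U oU <-].
    rewrite setTI; apply: sub_sigma_algebra; apply: open_comp => //.
    by move=> x _; exact: cvg_fst.
  have ms : @measurable_fun _ _ (g_sigma_algebraType (@open (X * K)%type))
      (borel K) setT snd.
    apply: (@measurability _ _ (g_sigma_algebraType (@open (X * K)%type))
      (borel K) setT snd (@open K)) => // _ [U oU <-].
    rewrite setTI; apply: sub_sigma_algebra; apply: open_comp => //.
    by move=> x _; exact: cvg_snd.
  by move=> E [] [A mA <-]; [exact: mf|exact: ms].
apply: smallest_sub; first by apply: sigma_algebra_measurable.
move=> U oU.
pose I := [set ab : set X * set K |
  [/\ BX ab.1, BK ab.2 & ab.1 `*` ab.2 `<=` U]].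
have -> : U = \bigcup_(ab in I) (ab.1 `*` ab.2).
  apply/seteqP; split => [[x y] Uxy|z [ab [_ _ abU] /abU]//].
  have [[P Q] /= [Px Qy] PQ] : nbhs (x, y) U by exact: open_nbhs_nbhs.
  have [a [Ba ax] aP] := bX x P Px.
  have [b [Bb yb] bQ] := bK y Q Qy.
  by exists (a, b) => //; split => // -[u v] [/= /aP ? /bQ ?]; exact: PQ.
rewrite bigcup_set_type.
apply: countable_bigcupT_measurable => [|[[a b] /= /set_mem[/= Ba Bb _]]].
  have : countable I.
    apply: (@sub_countable _ _ _ (BX `*` BK)); last exact: countableX.
    by apply: subset_card_le => ab [].
  by rewrite -(eq_countable (card_setT _)).
apply: measurableX; apply: sub_sigma_algebra; [exact: oX|exact: oK].
Qed.

Section metric_notions.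
Context {R : realType}.

Definition lipschitz_fun (X : metricType R) (g : X -> R) :=
  exists C : R, forall x y : X, `|g x - g y| <= C * mdist x y.

(* Lipschitz for the sum of the two distances; the canonical pseudometric on
   [X * K] uses their maximum instead. *)
Definition lipschitz_sum (X K : metricType R) (f : X * K -> R) :=
  exists C : R, forall u v : X * K,
    `|f u - f v| <= C * (mdist u.1 v.1 + mdist u.2 v.2).

Definition diam (K : metricType R) : R :=
  sup [set mdist y1 y2 | y1 in [set: K] & y2 in [set: K]].

End metric_notions.

Section charges.
Context d (T : measurableType d) {R : realType}.
Implicit Type nu : {charge set T -> \bar R}.

Definition hahn_pos nu : set T := sval (cid (Hahn_decomposition nu)).

Definition hahn_neg nu : set T :=
  sval (cid (svalP (cid (Hahn_decomposition nu)))).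

Lemma hahn_posnegP nu : hahn_decomposition nu (hahn_pos nu) (hahn_neg nu).
Proof. exact: svalP (cid (svalP (cid (Hahn_decomposition nu)))). Qed.

(* The parts of the Jordan decomposition do not depend on the choice of a Hahn
   decomposition. *)
Definition pos_part nu : {finite_measure set T -> \bar R} :=
  jordan_pos (hahn_posnegP nu).

Definition neg_part nu : {finite_measure set T -> \bar R} :=
  jordan_neg (hahn_posnegP nu).

Definition charge_integral nu (g : T -> R) : \bar R :=
  (\int[pos_part nu]_y (g y)%:E - \int[neg_part nu]_y (g y)%:E)%E.

Definition charge_pushforward d' (T' : measurableType d') (f : T -> T')
  (mf : measurable_fun [set: T] f) nu : {charge set T' -> \bar R}.
Proof. by refine (pushforward nu f); exact: mf. Defined.

End charges.

Section wasserstein.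
Context {R : realType} {K : pmetricType R}.

Definition W_test (g : K -> R) :=
  (forall y1 y2 : K, `|g y1 - g y2| <= mdist y1 y2) /\
  (forall y : K, `|g y| <= 1).

Definition W_norm (nu : {charge set (borel K) -> \bar R}) : \bar R :=
  ereal_sup [set `|charge_integral nu g|%E | g in W_test].

End wasserstein.

Section leaves.
Context {R : realType} {X K : pmetricType R}.
Local Notation Sigma := (borel X * borel K)%type.
Variable m : probability (borel X) R.
Implicit Type mu : {charge set Sigma -> \bar R}.
Implicit Type nu : {finite_measure set Sigma -> \bar R}.
Implicit Type kappa : X -> probability Sigma R.

Definition base_charge mu : {charge set (borel X) -> \bar R} :=
  charge_pushforward measurable_fst mu.

Definition base_density mu : X -> \bar R :=
  Radon_Nikodym (base_charge mu) m.

Definition AB mu : Prop :=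
  base_charge (charge_of_finite_measure (pos_part mu)) `<< m /\
  base_charge (charge_of_finite_measure (neg_part mu)) `<< m.

(* The clause "for phi_1 m-almost every x" is spelled out as: for m-almost
   every x with phi_1 x != 0. *)
Definition is_disintegration nu kappa : Prop :=
  let phi1 := base_density (charge_of_finite_measure nu) in
  [/\ {ae m, forall x, phi1 x != 0%E -> kappa x (fst @^-1` [set x]) = 1%E},
      forall E : set Sigma, measurable E ->
        measurable_fun [set: borel X] (fun x => kappa x E) &
      forall E : set Sigma, measurable E ->
        nu E = (\int[m]_x (kappa x E * phi1 x))%E].

Definition leaf_restriction_pos nu kappa (x : X) :
    {charge set (borel K) -> \bar R} :=
  cscale (fine (base_density (charge_of_finite_measure nu) x))
    (charge_pushforward measurable_snd (charge_of_finite_measure (kappa x))).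

Definition leaf_restriction mu kappap kappan (x : X) :
    {charge set (borel K) -> \bar R} :=
  cadd (leaf_restriction_pos (pos_part mu) kappap x)
       (copp (leaf_restriction_pos (neg_part mu) kappan x)).

Definition norm_infty mu kappap kappan : \bar R :=
  ess_sup m (fun x => W_norm (leaf_restriction mu kappap kappan x)).

(* Leaf restrictions are unique up to m-null sets, so [norm_infty] does not
   depend on the disintegrations. *)
Definition Linfty mu : Prop :=
  AB mu /\
  exists kappap kappan : X -> probability Sigma R,
    [/\ is_disintegration (pos_part mu) kappap,
        is_disintegration (neg_part mu) kappan &
        (norm_infty mu kappap kappan < +oo)%E].

(* [base_density mu] is a class modulo m; it is Lipschitz when it has a
   Lipschitz representative. *)
Definition Sinfty mu : Prop :=
  Linfty mu /\
  exists2 g : X -> R, lipschitz_fun g &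
    {ae m, forall x, base_density mu x = (g x)%:E}.

Definition Theta (mu0 : probability Sigma R) (f : X * K -> R) : Prop :=
  exists intf : mu0.-integrable [set: Sigma] (EFin \o f),
    Sinfty (induced_charge intf).

End leaves.

Section subshift.
Context {N : nat}.
Implicit Type A : 'M[nat]_N.

Record aperiodic A : Prop := Aperiodic {
  aperiodic_size : (0 < N)%N ;
  aperiodic_entry : forall i j, (A i j <= 1)%N ;
  aperiodic_power : exists2 n, (0 < n)%N & forall i j, (0 < (A ^+ n) i j)%N
}.

Lemma aperiodic_succ A : aperiodic A -> forall i, exists j, A i j = 1%N.
Proof.
move=> [_ A01 [[//|n] _ Apos]] i.
have := Apos i i; rewrite exprS mxE lt0n => /negP nz.
apply: contrapT => noj; apply: nz; apply/eqP; apply: big1 => k _.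
have := A01 i k; rewrite leq_eqVlt ltnS leqn0 => /orP[/eqP e|/eqP ->].
  by case: noj; exists k.
by rewrite mul0r.
Qed.

(* The proofs [hA] and [htheta] are parameters of the type so that it carries
   a base point and the distance d_theta. *)
Record sft (R : realType) A (theta : R) (hA : aperiodic A)
    (htheta : 0 < theta < 1) := Sft {
  sft_seq :> nat -> 'I_N ;
  sft_admissible : forall i, A (sft_seq i) (sft_seq i.+1) = 1%N
}.

Definition d_theta (R : realType) (theta : R) (x y : nat -> 'I_N) : R :=
  limn (series (fun i => theta ^+ i * (x i != y i)%:R)).

Section d_theta_lemmas.
Context (R : realType) (theta : R) (theta01 : 0 < theta < 1).
Implicit Types x y z : nat -> 'I_N.

Let term_ge0 x y i : 0 <= theta ^+ i * (x i != y i)%:R.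
Proof. by rewrite mulr_ge0// exprn_ge0//; case/andP: theta01 => /ltW. Qed.

Lemma d_theta_cvg x y :
  cvgn (series (fun i => theta ^+ i * (x i != y i)%:R)).
Proof.
case/andP: theta01 => t0 t1.
apply: (series_le_cvg (v_ := geometric 1 theta)) => //.
- by move=> i; rewrite /= mul1r exprn_ge0// ltW.
- by move=> i; rewrite /= mul1r ler_piMr//; [exact/exprn_ge0/ltW|case: (_ != _)].
- by apply: is_cvg_geometric_series; rewrite ger0_norm// ltW.
Qed.

Lemma d_thetaxx x : d_theta theta x x = 0.
Proof.
rewrite /d_theta (_ : series _ = cst 0) ?lim_cst//.
by apply/funext => n; rewrite /series/= big1// => i _; rewrite eqxx mulr0.
Qed.

Lemma d_theta_eq0 x y : d_theta theta x y = 0 -> x = y.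
Proof.
move=> xy0; apply/funext => i; apply/eqP; rewrite -[_ == _]negbK.
apply/negP => xyi.
have ti : 0 < theta ^+ i by rewrite exprn_gt0//; case/andP: theta01.
suff : theta ^+ i <= d_theta theta x y by rewrite xy0 leNgt ti.
apply: (@le_trans _ _ (series (fun i => theta ^+ i * (x i != y i)%:R) i.+1)).
  rewrite /series/= big_nat_recr//= xyi mulr1 lerDr.
  by apply: sumr_ge0 => j _; exact: term_ge0.
apply: nondecreasing_cvgn_le; last exact: d_theta_cvg.
by apply: nondecreasing_series => j _ _; exact: term_ge0.
Qed.

Lemma d_theta_sym x y : d_theta theta x y = d_theta theta y x.
Proof.
by congr (limn (series _)); apply/funext => i; rewrite eq_sym.
Qed.

Lemma d_theta_triangle y x z :
  d_theta theta x z <= d_theta theta x y + d_theta theta y z.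
Proof.
rewrite /d_theta -limD; [|exact: d_theta_cvg..].
apply: ler_lim; first exact: d_theta_cvg.
  by apply: is_cvgD; exact: d_theta_cvg.
apply: nearW => n; rewrite /series/= fctE -big_split/=; apply: ler_sum => i _.
rewrite -mulrDr ler_wpM2l ?exprn_ge0//; first by case/andP: theta01 => /ltW.
rewrite -natrD ler_nat.
by case: (eqVneq (x i) (y i)) => [->|_];
  [case: (_ != _)|case: (_ != _); case: (_ != _)].
Qed.

End d_theta_lemmas.

Section sft_instances.
Context (R : realType) A (theta : R) (hA : aperiodic A).
Context (theta01 : 0 < theta < 1).
Local Notation S := (sft hA theta01).

HB.instance Definition _ := gen_eqMixin S.
HB.instance Definition _ := gen_choiceMixin S.

Lemma sft_inj (x y : S) : sft_seq x = sft_seq y -> x = y.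
Proof.
case: x y => [x hx] [y hy] /= xy; case: _ / xy hy => hy.
by congr Sft; exact: Prop_irrelevance.
Qed.

Let next i : 'I_N := sval (cid (aperiodic_succ hA i)).

Let next_admissible i : A i (next i) = 1%N.
Proof. exact: svalP (cid (aperiodic_succ hA i)). Qed.

Let base_point : S :=
  @Sft R A theta hA theta01
    (fun n => iter n next (Ordinal (aperiodic_size hA)))
    (fun n => next_admissible _).

HB.instance Definition _ := isPointed.Build S base_point.

HB.instance Definition _ := @isMetric.Build R S
  (fun x y => d_theta theta x y)
  (fun x => d_thetaxx theta x)
  (fun x y xy0 => sft_inj (d_theta_eq0 theta01 xy0))
  (fun x y => d_theta_sym theta x y)
  (fun y x z => d_theta_triangle theta01 y x z).

Definition shift (x : S) : S :=
  @Sft R A theta hA theta01 (fun i => x i.+1) (fun i => sft_admissible x i.+1).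

Definition skew_product (K : Type) (G : S * K -> K) (u : S * K) : S * K :=
  (shift u.1, G u).

(* These cylinder values determine m, and imply its invariance under the
   shift. *)
Definition markov_measure (m : probability (borel S) R) : Prop :=
  exists (P : 'M[R]_N) (p : 'rV[R]_N),
    [/\ (forall i j, 0 <= P i j) /\ (forall i, \sum_j P i j = 1),
        forall i j, 0 < P i j <-> A i j = 1%N,
        (forall i, 0 <= p 0 i) /\ \sum_i p 0 i = 1,
        p *m P = p &
        forall (w : nat -> 'I_N) (n : nat),
          m [set x : S | forall i, (i <= n)%N -> x i = w i] =
          (p 0 (w 0%N) * \prod_(i < n) P (w i) (w i.+1))%:E].

End sft_instances.
End subshift.

(* Main.v *)
Require Import Defs.
From HB Require Import structures.
From mathcomp Require Import all_boot all_order all_algebra.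
From mathcomp Require Import all_classical all_reals all_analysis.
From mathcomp Require Import measurable_realfun ess_sup_inf.
From mathcomp Require Import ring lra.

Set Implicit Arguments.
Unset Strict Implicit.
Unset Printing Implicit Defensive.

Import Order.TTheory GRing.Theory Num.Theory.
Import numFieldNormedType.Exports.

Local Open Scope classical_set_scope.
Local Open Scope ring_scope.

(** Write F for the skew product, sigma for the shift, L for the Lipschitz
    constant of f and rho for the Lipschitz density of the marginal of mu0 with
    respect to m. Splitting f into its positive and negative parts, it is enough
    to treat a nonnegative f; the point is then that the marginal of f mu0 has a
    Lipschitz density, and everything else follows from it.

    Let T be the transfer operator of sigma, the adjoint of composition with
    sigma in L^2(m):
      (T phi)(x) = sum_i p_i P_{i x_0} / p_{x_0} phi(i x).
    Prefixing a letter contracts the base by theta, whence the inequality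
      Lip(T phi) <= theta Lip(phi) + 2 sup |phi|  ([transfer_lipschitz]).
    Fix a point y0 of K. As the leaves are contracted by alpha, f (F^n (x, y))
    differs from f (F^n (x, y0)) by at most L alpha^n, so that, by the
    invariance of mu0 and the duality between T and sigma,
      int_{C x K} f dmu0 = int 1_C(sigma^n x) f(F^n(x, y)) dmu0(x, y)
                         = int_C psi_n dm + O(alpha^n)
    where psi_n = T^n (x |-> f (F^n (x, y0)) rho(x)). The function under T^n has
    Lipschitz constant O(theta^-n), because sigma^n expands by theta^-n; the
    n applications of T compensate exactly this growth, and the psi_n are
    uniformly Lipschitz. They are also uniformly Cauchy, at the rate alpha^n,
    because T rho = rho. Their limit psi is the Lipschitz density
    ([lipschitz_leafwise_average]).

    Two remarks make this work pointwise rather than almost everywhere. The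
    measure m charges every nonempty cylinder, because some power of the transition
    matrix is positive; hence the contraction of the leaves, assumed for almost
    every x, holds for every x as G is Lipschitz in x
    ([contracting_everywhere]), and T rho = rho, true almost everywhere, holds
    everywhere as both sides are continuous ([transfer_rho]).

    The disintegration of the nonnegative measure f mu0 comes from that of mu0
    by normalizing f mu0_x on each leaf ([disintegration_density]). For a general
    f, the total variation of the leaf restrictions is at most the sum of the
    bounded densities obtained for the two parts of f, and it controls the
    Wasserstein norm ([W_norm_leaf_restriction]); this gives the finiteness of
    the norm ([Sinfty_induced_charge]). *)

(** * Integration against disintegrated measures and densities *)

Section disintegration_integral.
Local Open Scope ereal_scope.
Context d d' (X : measurableType d) (Y : measurableType d') {R : realType}.
Variables (m : {measure set X -> \bar R}) (nu : {measure set Y -> \bar R}).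
Variables (kappa : X -> {measure set Y -> \bar R}) (h : X -> R).
Hypothesis mkappa : forall E, measurable E ->
  measurable_fun [set: X] (kappa ^~ E).
Hypothesis mh : measurable_fun [set: X] h.
Hypothesis h0 : forall x, (0 <= h x)%R.
Hypothesis nuE : forall E, measurable E ->
  nu E = \int[m]_x (kappa x E * (h x)%:E).

Import HBNNSimple.

(** Both sides agree on indicators by [nuE], hence on simple functions, and
    monotone convergence passes to the limit. With Dirac fibres this is
    integration against a density, with fibres carried by the leaves it is
    integration along a disintegration. *)
Lemma ge0_integral_disintegration (f : Y -> \bar R) :
  measurable_fun [set: Y] f -> (forall y, 0 <= f y) ->
  \int[nu]_y f y = \int[m]_x ((\int[kappa x]_y f y) * (h x)%:E).
Proof.
move=> mf f0.
pose g := nnsfun_approx measurableT mf.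
have mg n : measurable_fun [set: Y] (EFin \o g n) by exact/measurable_EFinP.
have g0 n y : 0 <= (EFin \o g n) y by rewrite lee_fin.
have ndg y : {homo (fun n => (EFin \o g n) y) : a b / (a <= b)%N >-> a <= b}.
  by move=> a b ab; rewrite lee_fin; exact/lefP/nd_nnsfun_approx.
have cvgg (k : {measure set Y -> \bar R}) :
    \int[k]_y (EFin \o g n) y @[n --> \oo] --> \int[k]_y f y.
  rewrite (_ : \int[k]_y f y = \int[k]_y limn (fun n => (EFin \o g n) y)).
    by apply: cvg_monotone_convergence => // y _; exact: ndg.
  by apply: eq_integral => y _; apply/esym/cvg_lim => //; exact: cvg_nnsfun_approx.
have gE n (k : {measure set Y -> \bar R}) : \int[k]_y (EFin \o g n) y =
    \sum_(r \in range (g n)) r%:E * k (g n @^-1` [set r]).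
  by rewrite integralT_nnsfun sintegralE.
have mint (u : Y -> \bar R) : measurable_fun [set: Y] u ->
    (forall y, 0 <= u y) ->
    measurable_fun [set: X] (fun x => (\int[kappa x]_y u y) * (h x)%:E).
  move=> mu u0; apply: emeasurable_funM; last exact/measurable_EFinP.
  exact: measurable_fun_integral_kernel.
have step n : \int[nu]_y (EFin \o g n) y =
    \int[m]_x ((\int[kappa x]_y (EFin \o g n) y) * (h x)%:E).
  have term0 r (k : {measure set Y -> \bar R}) :
      0 <= r%:E * k (g n @^-1` [set r]).
    have [r0'|r0'] := leP 0%R r; first by rewrite mule_ge0// lee_fin.
    by rewrite preimage_nnfun0// measure0 mule0.
  rewrite gE; under [RHS]eq_integral do rewrite gE ge0_mule_fsuml//.
  rewrite ge0_integral_fsum//=; last 2 first.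
  - move=> r; apply: emeasurable_funM; last exact/measurable_EFinP.
    by apply: measurable_funeM; exact: mkappa.
  - by move=> r x _; rewrite mule_ge0// lee_fin.
  apply: eq_fsbigr => r /set_mem[y _ <-].
  under eq_integral do rewrite -muleA.
  rewrite ge0_integralZl_EFin//; first by rewrite nuE.
  - by move=> x _; rewrite mule_ge0// lee_fin.
  - by apply: emeasurable_funM; [exact: mkappa|exact/measurable_EFinP].
apply: (@cvg_unique _ (@ereal_hausdorff R) (\int[nu]_y (EFin \o g n) y @[n --> \oo])).
  exact: cvgg.
rewrite (funext step).
rewrite (_ : \int[m]_x _ = \int[m]_x
    limn (fun n => (\int[kappa x]_y (EFin \o g n) y) * (h x)%:E)); last first.
  apply: eq_integral => x _; apply/esym/cvg_lim => //.
  by apply: cvgeZr => //; exact: cvgg.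
apply: cvg_monotone_convergence => // [n|n x _|x _ a b ab].
- exact: mint.
- by rewrite mule_ge0 ?lee_fin//; exact: integral_ge0.
- rewrite lee_wpmul2r ?lee_fin//; apply: ge0_le_integral => // y _.
  exact: ndg.
Qed.

End disintegration_integral.

Section almost_everywhere.
Context d (T : measurableType d) {R : realType} (mu : {measure set T -> \bar R}).
Implicit Types P Q S : T -> Prop.

Lemma ae_mp P Q : (forall x, P x -> Q x) ->
  {ae mu, forall x, P x} -> {ae mu, forall x, Q x}.
Proof. by move=> PQ; apply: filterS. Qed.

Lemma ae_mp2 P Q S : (forall x, P x -> Q x -> S x) ->
  {ae mu, forall x, P x} -> {ae mu, forall x, Q x} -> {ae mu, forall x, S x}.
Proof. by move=> PQ; apply: filterS2. Qed.

End almost_everywhere.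

Section density.
Local Open Scope ereal_scope.
Context d (X : measurableType d) {R : realType}.
Variables (m nu : {measure set X -> \bar R}) (h : X -> R).
Hypothesis mh : measurable_fun [set: X] h.
Hypothesis h0 : forall x, (0 <= h x)%R.
Hypothesis nuE : forall E, measurable E -> nu E = \int[m]_(x in E) (h x)%:E.

Lemma ge0_integral_density D (f : X -> \bar R) : measurable D ->
  measurable_fun D f -> (forall x, D x -> 0 <= f x) ->
  \int[nu]_(x in D) f x = \int[m]_(x in D) (f x * (h x)%:E).
Proof.
move=> mD mf f0.
have fD0 x : 0 <= (f \_ D) x.
  by rewrite patchE; case: ifPn => // /set_mem; exact: f0.
have mfD : measurable_fun [set: X] (f \_ D) by rewrite -measurable_restrictT.
rewrite integral_mkcond [RHS]integral_mkcond.
rewrite (@ge0_integral_disintegration _ _ _ _ _ m nu (fun x => \d_x) h)//.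
- apply: eq_integral => x _; rewrite integral_dirac// diracT mul1e !patchE.
  by case: ifPn => //; rewrite mul0e.
- move=> E mE; rewrite (_ : (fun x => _) = EFin \o \1_E)//.
  exact/measurable_EFinP.
- move=> E mE; rewrite nuE// integral_mkcond; apply: eq_integral => x _.
  rewrite -[X in X * _]/((\1_E x)%:E) indicE patchE; case: (x \in E); first by rewrite mul1e.
  by rewrite mul0e.
Qed.

End density.

Section density_measure.
Local Open Scope ereal_scope.
Context d (X : measurableType d) {R : realType}.
Variables (m : {measure set X -> \bar R}) (h : X -> R).
Hypothesis mh : measurable_fun [set: X] h.
Hypothesis h0 : forall x, (0 <= h x)%R.

(** The proofs of measurability and nonnegativity are arguments, so that the
    measure structure can be inferred from the term. *)
Definition density_measure of measurable_fun [set: X] h &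
  (forall x, (0 <= h x)%R) := fun E => \int[m]_(x in E) (h x)%:E.

Let density_measure0 : density_measure mh h0 set0 = 0.
Proof. exact: integral_set0. Qed.

Let density_measure_ge0 E : 0 <= density_measure mh h0 E.
Proof. by apply: integral_ge0 => x _; rewrite lee_fin. Qed.

Let density_measure_sigma_additive : semi_sigma_additive (density_measure mh h0).
Proof.
apply: semi_sigma_additive_nng_induced; first exact/measurable_EFinP.
by move=> x; rewrite lee_fin.
Qed.

HB.instance Definition _ := isMeasure.Build _ _ _ (density_measure mh h0)
  density_measure0 density_measure_ge0 density_measure_sigma_additive.

End density_measure.

(** * Jordan decompositions *)

Section jordan.
Local Open Scope ereal_scope.
Context d (T : measurableType d) {R : realType}.

Lemma pos_partE (nu : {charge set T -> \bar R}) E : measurable E ->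
  pos_part nu E = nu (E `&` hahn_pos nu).
Proof. by move=> mE; rewrite /= /jordan_pos /= /measure_of_charge /= /crestr0 mem_set. Qed.

Lemma neg_partE (nu : {charge set T -> \bar R}) E : measurable E ->
  neg_part nu E = - nu (E `&` hahn_neg nu).
Proof. by move=> mE; rewrite [LHS]jordan_negE cjordan_negE /crestr0 mem_set. Qed.

(** The pair made of the full and the empty set is a Hahn decomposition, and
    Jordan parts do not depend on the Hahn decomposition. *)
Lemma pos_part_finite_measure (nu : {finite_measure set T -> \bar R}) E :
  measurable E -> pos_part (charge_of_finite_measure nu) E = nu E.
Proof.
move=> mE; rewrite pos_partE//.
have hT : hahn_decomposition (charge_of_finite_measure nu) setT set0.
  split; rewrite ?setU0 ?setI0//; last exact: negative_set0.
have [e _] := Hahn_decomposition_uniq (hahn_posnegP _) hT mE.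
by rewrite setIT in e.
Qed.

Section induced.
Variables (mu : {measure set T -> \bar R}) (f : T -> R).
Hypothesis intf : mu.-integrable [set: T] (EFin \o f).

Let mf : measurable_fun [set: T] f.
Proof. by apply/measurable_EFinP; exact: measurable_int intf. Qed.

Let nonneg := f @^-1` `[0%R, +oo[.

Let mnonneg : measurable nonneg.
Proof. by rewrite -[nonneg]setTI; exact: mf. Qed.

Let hahn_induced :
  hahn_decomposition (induced_charge intf) nonneg (~` nonneg).
Proof.
split; rewrite ?setUv ?setICr//; split => //; first last.
- move=> A mA Af; rewrite /induced_charge -[leLHS]oppeK leeNl oppe0.
  rewrite -integralN; last first.
    apply/integrable_add_def/(integrableS measurableT) => //.
  apply: integral_ge0 => x /Af /=.
  rewrite /nonneg/= in_itv/= andbT => /negP; rewrite -ltNge => fx.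
  by rewrite lee_fin oppr_ge0 ltW.
- exact: measurableC.
- move=> A mA Af; apply: integral_ge0 => x /Af /=.
  by rewrite /nonneg/= in_itv/= andbT lee_fin.
Qed.

(** The sign of [f] provides a Hahn decomposition of [f mu]. *)
Lemma pos_part_induced E : measurable E ->
  pos_part (induced_charge intf) E = \int[mu]_(x in E) (Num.max (f x) 0)%:E.
Proof.
move=> mE; rewrite pos_partE//.
have [-> _] := Hahn_decomposition_uniq (hahn_posnegP _) hahn_induced mE.
rewrite -[LHS]/(\int[mu]_(x in E `&` nonneg) (f x)%:E) integral_mkcondr.
apply: eq_integral => x _.
rewrite patchE; case: ifPn; rewrite ?(notin_setE, inE) /nonneg/= in_itv/= andbT.
  by move=> fx; rewrite max_l.
by move/negP; rewrite -ltNge => fx; rewrite max_r// ltW.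
Qed.

Lemma neg_part_induced E : measurable E ->
  neg_part (induced_charge intf) E = \int[mu]_(x in E) (Num.max (- f x) 0)%:E.
Proof.
move=> mE; rewrite neg_partE//.
have [_ ->] := Hahn_decomposition_uniq (hahn_posnegP _) hahn_induced mE.
have mEN : measurable (E `&` ~` nonneg).
  by apply: measurableI => //; exact: measurableC.
rewrite -[LHS]/(- \int[mu]_(x in E `&` ~` nonneg) (f x)%:E) -integralN; last first.
  exact/integrable_add_def/(integrableS measurableT).
rewrite integral_mkcondr; apply: eq_integral => x _.
rewrite patchE; case: ifPn; rewrite ?(notin_setE, inE) /nonneg/= in_itv/= andbT.
  by move/negP; rewrite -ltNge => fx; rewrite max_l// oppr_ge0 ltW.
by move=> /contrapT fx; rewrite max_r// oppr_le0.
Qed.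

End induced.
End jordan.

(** * Densities and disintegrations on the leaves *)

Section concentrated.
Local Open Scope ereal_scope.
Context d (T : measurableType d) {R : realType}.

Lemma ge0_integral_concentrated (P : probability T R) (D E : set T)
    (f : T -> \bar R) : measurable D -> measurable E -> P D = 1 ->
    measurable_fun [set: T] f -> (forall x, 0 <= f x) ->
  \int[P]_(x in E) f x = \int[P]_(x in E `&` D) f x.
Proof.
move=> mD mE PD mf f0.
rewrite (@ge0_negligible_integral _ _ _ _ _ (~` D))//.
- by rewrite setDE setCK.
- exact: measurableC.
- exact: measurable_funTS.
- by have := probability_setC P mD; rewrite PD subee.
Qed.

End concentrated.

Section leaves.
Local Open Scope ereal_scope.
Context {R : realType} {X K : pmetricType R}.
Local Notation Sigma := (borel X * borel K)%type.
Variable m : probability (borel X) R.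

Lemma measurable_fiber (C : set (borel X)) : measurable C ->
  measurable (fst @^-1` C : set Sigma).
Proof. by move=> mC; rewrite -[X in measurable X]setTI; exact: measurable_fst. Qed.

Lemma measurable_borel_set1 (x : borel X) : measurable [set x].
Proof.
rewrite -[X in measurable X]setCK; apply: measurableC.
apply: sub_sigma_algebra; rewrite openC.
exact/(@accessible_closed_set1 X)/hausdorff_accessible/metric_hausdorff.
Qed.

Lemma base_chargeE (mu : {charge set Sigma -> \bar R}) C :
  base_charge mu C = mu (fst @^-1` C).
Proof. by []. Qed.

Lemma measurable_base_density (mu : {charge set Sigma -> \bar R}) :
  measurable_fun [set: borel X] (base_density m mu).
Proof.
have [dom|ndom] := pselect (base_charge mu `<< m).
  exact/measurable_int/Radon_Nikodym_integrable.
by rewrite /base_density /Radon_Nikodym; case: pselect.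
Qed.

Section density.
Variables (mu : {charge set Sigma -> \bar R}) (h : X -> \bar R).
Hypothesis inth : m.-integrable [set: borel X] h.
Hypothesis muh : forall C : set (borel X), measurable C ->
  mu (fst @^-1` C) = \int[m]_(x in C) h x.

Lemma base_charge_dominates : base_charge mu `<< m.
Proof.
apply/null_content_dominatesP => C mC mC0; rewrite base_chargeE muh//.
rewrite (negligible_integral mC mC)//; last exact: (integrableS measurableT).
by rewrite setDv integral_set0.
Qed.

(** Radon-Nikodym derivatives are characterized almost everywhere by their
    integrals. *)
Lemma base_density_ae : {ae m, forall x, base_density m mu x = h x}.
Proof.
have dom := base_charge_dominates.
have : ae_eq m setT (base_density m mu) h.
  apply: integral_ae_eq => //.
  - exact: Radon_Nikodym_integrable.
  - exact: measurable_int inth.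
  - by move=> C _ mC; rewrite -Radon_Nikodym_integral// base_chargeE muh.
by apply: ae_mp => x; exact.
Qed.

End density.

Section disintegration.
Variables (nu0 nu : {finite_measure set Sigma -> \bar R}).
Variables (kappa : X -> probability Sigma R) (h : X -> R) (f : Sigma -> R) (M : R).
Hypothesis kappaP : is_disintegration m nu0 kappa.
Hypothesis mh : measurable_fun [set: borel X] h.
Hypothesis h0 : forall x, (0 <= h x)%R.
Hypothesis hE :
  {ae m, forall x, base_density m (charge_of_finite_measure nu0) x = (h x)%:E}.
Hypothesis mf : measurable_fun [set: Sigma] f.
Hypothesis f0 : forall u, (0 <= f u)%R.
Hypothesis fM : forall u, (f u <= M)%R.
Hypothesis nuE : forall E, measurable E -> nu E = \int[nu0]_(u in E) (f u)%:E.

Let mkappa E : measurable E -> measurable_fun [set: borel X] (kappa ^~ E).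
Proof. by case: kappaP => _ + _; exact. Qed.

Let g x : {measure set Sigma -> \bar R} := density_measure (kappa x) mf f0.

Let mfE : measurable_fun [set: Sigma] (EFin \o f).
Proof. exact/measurable_EFinP. Qed.

Let mint (u : Sigma -> \bar R) : measurable_fun [set: Sigma] u ->
  (forall z, 0 <= u z) -> measurable_fun [set: borel X] (fun x => \int[kappa x]_z u z).
Proof. by move=> mu u0; exact: measurable_fun_integral_kernel. Qed.

Let fD0 E u : 0 <= ((EFin \o f) \_ E) u.
Proof. by rewrite patchE; case: ifPn => //=; rewrite lee_fin. Qed.

Let mg E : measurable E -> measurable_fun [set: borel X] (g ^~ E).
Proof.
move=> mE; rewrite (_ : g ^~ E = fun x => \int[kappa x]_u ((EFin \o f) \_ E) u).
  by apply: mint => //; rewrite -measurable_restrictT//; exact: measurable_funTS.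
by apply/funext => x; rewrite /g/= /density_measure integral_mkcond.
Qed.

Let mnormalize_g E : measurable E ->
  measurable_fun [set: borel X]
    (fun x => mnormalize (g x) (\d_point : probability Sigma R) E).
Proof.
pose gmix := isKernel.Build _ _ (borel X) Sigma R g mg.
pose gker : R.-ker (borel X) ~> Sigma := HB.pack g gmix.
exact: (measurable_kernel (knormalize gker _)).
Qed.

Let g_fin x E : measurable E -> g x E \is a fin_num.
Proof.
move=> mE; rewrite ge0_fin_numE//.
rewrite (@le_lt_trans _ _ (\int[kappa x]_(u in E) (cst M%:E) u))//.
  apply: ge0_le_integral => //.
  - by move=> u _; rewrite lee_fin.
  - exact: measurable_funTS.
  - by move=> u _; rewrite lee_fin.
rewrite integral_cst// (@le_lt_trans _ _ `|M|%:E)// ?ltry//.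
apply: (@le_trans _ _ (`|M|%:E * kappa x E)).
  by rewrite lee_wpmul2r// lee_fin ler_norm.
by rewrite -[leRHS]mule1 lee_wpmul2l// probability_le1.
Qed.

Let nu0E E : measurable E -> nu0 E = \int[m]_x (kappa x E * (h x)%:E).
Proof.
move=> mE; case: (kappaP) => _ _ ->//; apply: ae_eq_integral => //.
- by apply: emeasurable_funM; [exact: mkappa|exact: measurable_base_density].
- by apply: emeasurable_funM; [exact: mkappa|exact/measurable_EFinP].
- by move: hE; apply: ae_mp => x -> _.
Qed.

Let nuEg E : measurable E -> nu E = \int[m]_x (g x E * (h x)%:E).
Proof.
move=> mE; rewrite nuE// integral_mkcond.
rewrite (@ge0_integral_disintegration _ _ _ _ _ m nu0 kappa h)//.
- by apply: eq_integral => x _; rewrite /g/= /density_measure integral_mkcond.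
- by rewrite -measurable_restrictT//; exact: measurable_funTS.
Qed.

(** As [kappa x] lives on the leaf over [x], the preimage of a base set [C]
    is seen by it either entirely or not at all. *)
Let leafwise : {ae m, forall x, h x != 0%R ->
  forall C : set (borel X), measurable C ->
    g x (fst @^-1` C) = (\1_C x)%:E * g x setT}.
Proof.
case: kappaP => + _ _; apply: ae_mp2 hE => x -> kx hx C mC.
have {}kx : kappa x (fst @^-1` [set x]) = 1 by apply: kx; rewrite eqe.
have mx := measurable_fiber (measurable_borel_set1 x).
have gx E : measurable E -> g x E = g x (E `&` fst @^-1` [set x]).
  by move=> mE; exact: ge0_integral_concentrated.
rewrite gx; last exact: measurable_fiber.
rewrite indicE; have [xC|xC] := boolP (x \in C).
  rewrite mul1e [RHS]gx// setTI; congr (g x _).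
  by apply/seteqP; split => [u []//|u /= ux]; split => //; rewrite ux; exact: set_mem.
rewrite mul0e (_ : _ `&` _ = set0) ?measure0//.
apply/seteqP; split => // u [/= uC ux]; move: xC; rewrite notin_setE; apply.
by rewrite -ux.
Qed.

Let densE : {ae m, forall x,
  base_density m (charge_of_finite_measure nu) x = g x setT * (h x)%:E}.
Proof.
have mgh : measurable_fun [set: borel X] (fun x => g x setT * (h x)%:E).
  by apply: emeasurable_funM; [exact: mg|exact/measurable_EFinP].
apply: base_density_ae.
  apply/integrableP; split => //.
  under eq_integral do rewrite gee0_abs ?mule_ge0 ?lee_fin//.
  by rewrite -nuEg// -ge0_fin_numE// fin_num_measure.
move=> C mC; rewrite [LHS]nuEg; last exact: measurable_fiber.
rewrite [RHS]integral_mkcond; apply: ae_eq_integral => //.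
- apply: emeasurable_funM; last exact/measurable_EFinP.
  by apply: mg; exact: measurable_fiber.
- by rewrite -measurable_restrictT//; exact: measurable_funTS.
- move: leafwise; apply: ae_mp => x gx _; rewrite patchE.
  have [hx|hx] := eqVneq (h x) 0%R.
    by rewrite hx !mule0; case: ifP.
  by rewrite gx// indicE; case: ifPn; rewrite ?mul1e ?mul0e.
Qed.

(** The disintegration of [f nu0] is [f kappa x] normalized on each leaf. The
    normalizing factor is what multiplies the base density [h], so the two
    cancel; where the factor vanishes, so does the base density of [f nu0] and
    the value of the disintegration is arbitrary, here a Dirac mass. *)
Lemma disintegration_density : exists kappa', is_disintegration m nu kappa'.
Proof.
exists (fun x => mnormalize (g x) (\d_point : probability Sigma R)).
have gfin x : g x setT == +oo = false by apply/negbTE; have := g_fin x measurableT;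
  rewrite fin_numE => /andP[].
split.
- apply: ae_mp2 leafwise densE => x gx ->; rewrite mule_eq0 negb_or eqe.
  move=> /andP[g0 hx]; rewrite /= /mnormalize (negbTE g0) gfin/=.
  rewrite gx//; last exact: measurable_borel_set1.
  rewrite indicE mem_set// mul1e -[X in X * _]fineK ?g_fin// -EFinM divff//.
  by rewrite fine_eq0 ?g_fin.
- exact: mnormalize_g.
- move=> E mE; rewrite nuEg//; apply: ae_eq_integral => //.
  + by apply: emeasurable_funM; [exact: mg|exact/measurable_EFinP].
  + apply: emeasurable_funM; last exact: measurable_base_density.
    exact: mnormalize_g.
  + apply: ae_mp densE => x -> _; rewrite /= /mnormalize gfin orbF.
    case: ifPn => [/eqP g0|g0].
      rewrite g0 !mul0e mule0; apply/eqP; rewrite mule_eq0; apply/orP; left.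
      by rewrite -measure_le0 -g0 le_measure// inE.
    rewrite muleA; congr (_ * _); rewrite -muleA -[X in _ * (_ * X)]fineK ?g_fin//.
    by rewrite -EFinM mulVf ?mule1// fine_eq0 ?g_fin.
Qed.

End disintegration.
End leaves.

(** * Lipschitz functions and the Wasserstein norm *)

Section borel_measurability.
Context {R : realType}.

Lemma measurable_fun_open d (T : measurableType d) (g : T -> R) :
  (forall U : set R, open U -> measurable (g @^-1` U)) ->
  measurable_fun [set: T] g.
Proof.
move=> gU; apply: (measurability _ (RGenOInfty.measurableE R)).
by move=> _ [_ [x ->] <-]; rewrite setTI; apply: gU; exact: interval_open.
Qed.

Lemma lipschitz_fun_ge0 (X : metricType R) (g : X -> R) : lipschitz_fun g ->
  exists2 C, 0 <= C & forall x y, `|g x - g y| <= C * mdist x y.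
Proof.
move=> [C gC]; exists `|C| => // x y; rewrite (le_trans (gC x y))//.
by rewrite ler_wpM2r ?mdist_ge0// ler_norm.
Qed.

Lemma ler_dist_max0 (a b : R) : `|Num.max a 0 - Num.max b 0| <= `|a - b|.
Proof.
have := ler_norm (a - b); have := ler_norm (b - a); rewrite (distrC b a).
rewrite ler_norml /Order.max.
by case: (ltP a 0) => ?; case: (ltP b 0) => ? ? ?; apply/andP; split; lra.
Qed.

(** The default value of a supremum is [0], so a positive diameter is a true
    upper bound. *)
Lemma mdist_le_diam (X : metricType R) (x y : X) :
  0 < diam X -> mdist x y <= diam X.
Proof.
move=> diam_gt0; apply: ub_le_sup; last by exists x => //; exists y.
apply: contrapT => unbounded; move: diam_gt0.
by rewrite /diam sup_out ?ltxx// => -[].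
Qed.

Lemma lipschitz_fun_continuous (X : pmetricType R) (g : X -> R) :
  lipschitz_fun g -> continuous g.
Proof.
move=> [C gC] x; apply/cvgrPdist_le => /= e e0.
have C0 : 0 < `|C| + 1 by rewrite ltr_wpDl.
near=> y; rewrite (le_trans (gC _ _))// (@le_trans _ _ ((`|C| + 1) * mdist x y))//.
  by rewrite ler_wpM2r ?mdist_ge0// (le_trans (ler_norm C))// lerDl.
rewrite mulrC -ler_pdivlMr// ltW//.
near: y; apply/nbhs_ballP; exists (e / (`|C| + 1)) => /=; first by rewrite divr_gt0.
by move=> y; rewrite ballEmdist.
Unshelve. all: by end_near. Qed.

Lemma lipschitz_fun_measurable (X : pmetricType R) (g : X -> R) :
  lipschitz_fun g -> measurable_fun [set: borel X] g.
Proof.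
move=> /lipschitz_fun_continuous/continuousP gC; apply: measurable_fun_open => U oU.
by apply: sub_sigma_algebra; exact: gC.
Qed.

Lemma lipschitz_map_measurable (X Y : pmetricType R) (g : X -> Y) (C : R) :
  (forall x y, mdist (g x) (g y) <= C * mdist x y) ->
  measurable_fun [set: borel X] (g : borel X -> borel Y).
Proof.
move=> gC; apply: (@measurability _ _ (borel X) (borel Y) setT g (@open Y)) => //.
move=> _ [U oU <-]; rewrite setTI; apply: sub_sigma_algebra.
move: U oU; apply/continuousP => x; apply/cvg_ballP => e e0; apply/nbhs_ballP.
have C0 : 0 < `|C| + 1 by rewrite ltr_wpDl.
exists (e / (`|C| + 1)) => /=; first by rewrite divr_gt0.
move=> y; rewrite !ballEmdist /= ltr_pdivlMr// mulrC => xy.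
apply: le_lt_trans (gC _ _) (le_lt_trans _ xy).
by rewrite ler_wpM2r ?mdist_ge0// (le_trans (ler_norm C))// lerDl.
Qed.

(** Second countability is what identifies the product sigma-algebra with the
    Borel sigma-algebra of the product. *)
Lemma lipschitz_sum_measurable (X K : pmetricType R) (f : X * K -> R) :
  @second_countable X -> @second_countable K -> lipschitz_sum f ->
  measurable_fun [set: borel X * borel K] f.
Proof.
move=> cX cK [C fC]; apply: measurable_fun_open => U oU.
rewrite measurable_borel_prod//; apply: sub_sigma_algebra.
have : continuous f.
  move=> u; apply/cvgrPdist_le => /= e e0.
  have C0 : 0 < `|C| + 1 by rewrite ltr_wpDl.
  near=> v; rewrite (le_trans (fC _ _))//.
  rewrite (@le_trans _ _ ((`|C| + 1) * (mdist u.1 v.1 + mdist u.2 v.2)))//.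
    by rewrite ler_wpM2r ?addr_ge0 ?mdist_ge0// (le_trans (ler_norm C))// lerDl.
  rewrite mulrC -ler_pdivlMr// [leRHS]splitr lerD// ltW//.
  + near: v; exists (ball u.1 (e / (`|C| + 1) / 2), setT) => [|v [+ _]].
      by split; [apply: nbhsx_ballx; rewrite !divr_gt0|exact: filterT].
    by rewrite /= ballEmdist.
  + near: v; exists (setT, ball u.2 (e / (`|C| + 1) / 2)) => [|v [_ +]].
      by split; [exact: filterT|apply: nbhsx_ballx; rewrite !divr_gt0].
    by rewrite /= ballEmdist.
by move=> /continuousP; exact.
Unshelve. all: by end_near. Qed.

End borel_measurability.

Section wasserstein_bound.
Local Open Scope ereal_scope.
Context {R : realType} {K : pmetricType R}.

(** Test functions are bounded by [1], so each Jordan part contributes at most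
    its mass, which is the value of [nu] on one half of a Hahn decomposition. *)
Lemma W_norm_le (nu : {charge set (borel K) -> \bar R}) (c : R) :
  (forall E, measurable E -> `|nu E| <= c%:E) -> W_norm nu <= (c + c)%:E.
Proof.
move=> nuc; apply: ge_ereal_sup => _ [g [gL g1] <-].
have mg : measurable_fun [set: borel K] g.
  by apply: lipschitz_fun_measurable; exists 1%R => x y; rewrite mul1r.
have bound (mu : {finite_measure set (borel K) -> \bar R}) : mu setT <= c%:E ->
    `|\int[mu]_y (g y)%:E| <= c%:E.
  move=> muc; apply: le_trans (le_abse_integral _ _ _) _ => //.
    exact/measurable_EFinP.
  apply: le_trans (integral_le_bound 1 _ _ _ _) _ => //.
  - exact/measurable_EFinP.
  - by apply: aeW => x _; rewrite lee_fin.
  - by rewrite mul1e.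
rewrite /charge_integral EFinD (le_trans (lee_abs_sub _ _))// leeD// bound//.
- have [[mP _] _ _ _] := hahn_posnegP nu.
  by rewrite pos_partE// setTI (le_trans (lee_abs _))// nuc.
- have [_ [mN _] _ _] := hahn_posnegP nu.
  by rewrite neg_partE// setTI (le_trans (lee_abs _))// abseN nuc.
Qed.

Lemma W_norm_leaf_restriction (X : pmetricType R) (m : probability (borel X) R)
    (mu : {charge set (borel X * borel K)%type -> \bar R})
    (kp kn : X -> probability (borel X * borel K)%type R) (x : X) (c : R) :
  `|base_density m (charge_of_finite_measure (pos_part mu)) x| <= c%:E ->
  `|base_density m (charge_of_finite_measure (neg_part mu)) x| <= c%:E ->
  W_norm (leaf_restriction m mu kp kn x) <= (c *+ 4)%:E.
Proof.
move=> pc nc.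
have bound (b : \bar R) (k : probability (borel X * borel K)%type R)
    (E : set (borel K)) : measurable E -> `|b| <= c%:E ->
    `|(fine b)%:E * k (snd @^-1` E)| <= c%:E.
  move=> mE bc.
  have mE' : measurable (snd @^-1` E : set (borel X * borel K)).
    by rewrite -[X in measurable X]setTI; exact: measurable_snd.
  rewrite abseM -[leRHS]mule1 lee_pmul//; first by case: b bc.
  by rewrite gee0_abs// probability_le1.
rewrite (_ : c *+ 4 = (c + c) + (c + c))%R; last by ring.
apply: W_norm_le => E mE.
pose dens (nu : {finite_measure set (borel X * borel K)%type -> \bar R}) :=
  base_density m (charge_of_finite_measure nu) x.
rewrite [X in `|X|](_ : _ =
    (fine (dens (pos_part mu)))%:E * kp x (snd @^-1` E) -
    (fine (dens (neg_part mu)))%:E * kn x (snd @^-1` E))//.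
by rewrite EFinD (le_trans (lee_abs_sub _ _))// leeD// bound.
Qed.

End wasserstein_bound.

(** * The metric and the cylinders of the subshift *)

Section subshift_metric.
Context (R : realType) (N : nat) (A : 'M[nat]_N) (theta : R).
Context (hA : aperiodic A) (theta01 : 0 < theta < 1).
Local Notation S := (sft hA theta01).
Local Notation sigma := (@Defs.shift N R A theta hA theta01).
Implicit Types x y : S.

Let theta_gt0 : 0 < theta. Proof. by case/andP: theta01. Qed.
Let theta_lt1 : theta < 1. Proof. by case/andP: theta01. Qed.

(** Peeling off the first letter; the estimates of [d_theta] below follow from
    this identity by induction. *)
Lemma mdist_shift x y :
  mdist x y = (x 0%N != y 0%N)%:R + theta * mdist (sigma x) (sigma y).
Proof.
have cvgd := d_theta_cvg theta01.
pose u (x y : nat -> 'I_N) i : R := theta ^+ i * (x i != y i)%:R.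
have e n : series (u x y) n.+1 =
    (x 0%N != y 0%N)%:R + theta * series (u (sigma x) (sigma y)) n.
  rewrite /series/= big_nat_recl// /u expr0 mul1r mulr_sumr; congr (_ + _).
  by apply: eq_bigr => i _; rewrite exprS mulrA.
apply: (@cvg_unique _ (@Rhausdorff R) (series (u x y) n.+1 @[n --> \oo])).
  have : series (u x y) @ \oo --> (mdist x y : R) by exact: cvgd.
  by rewrite -(cvg_shiftS (series (u x y))).
rewrite (funext e); apply: cvgD; first exact: cvg_cst.
by apply: cvgMr; exact: cvgd.
Qed.

Lemma mdist_sft_le x y : mdist x y <= (1 - theta)^-1.
Proof.
apply: limr_le; first exact: d_theta_cvg.
apply: nearW => n; apply: (@le_trans _ _ (series (geometric 1 theta) n)).
  apply: ler_sum => i _; rewrite /geometric/= mul1r ler_piMr//.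
    by rewrite exprn_ge0// ltW.
  by case: (_ != _).
rewrite geometric_seriesE ?lt_eqF//= mul1r ler_piMl//.
  by rewrite invr_ge0 subr_ge0 ltW.
by rewrite lerBlDr lerDl exprn_ge0// ltW.
Qed.

Lemma lipschitz_sft_bounded (phi : S -> R) : lipschitz_fun phi ->
  exists2 c, 0 <= c & forall x, `|phi x| <= c.
Proof.
move=> [C phiC]; exists (`|phi point| + `|C| * (1 - theta)^-1).
  by rewrite addr_ge0// mulr_ge0// invr_ge0 subr_ge0 ltW.
move=> x; rewrite -[phi x](subrK (phi point)) addrC (le_trans (ler_normD _ _))//.
rewrite lerD// (le_trans (phiC _ _))// (@le_trans _ _ (`|C| * mdist x point))//.
  by rewrite ler_wpM2r ?mdist_ge0// ler_norm.
by rewrite ler_wpM2l// mdist_sft_le.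
Qed.

Lemma mdist_shift_le x y : mdist (sigma x) (sigma y) <= theta^-1 * mdist x y.
Proof.
rewrite ler_pdivlMl// [leRHS]mdist_shift lerDr.
by case: (_ != _).
Qed.

Lemma mdist_iter_shift_le n x y :
  mdist (iter n sigma x) (iter n sigma y) <= theta^-1 ^+ n * mdist x y.
Proof.
elim: n => [|n IHn]; first by rewrite mul1r.
rewrite !iterS (le_trans (mdist_shift_le _ _))// exprS -mulrA.
by rewrite ler_wpM2l// invr_ge0 ltW.
Qed.

Lemma mdist_agree n x y : (forall i, (i < n)%N -> x i = y i) ->
  mdist x y <= theta ^+ n / (1 - theta).
Proof.
elim: n x y => [|n IHn] x y xy; first by rewrite mul1r mdist_sft_le.
rewrite mdist_shift xy// eqxx add0r exprS -mulrA (ler_wpM2l (ltW theta_gt0))//.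
by apply: IHn => i ni; exact: xy.
Qed.

Lemma mdist_disagree n x y : x n != y n -> theta ^+ n <= mdist x y.
Proof.
elim: n x y => [|n IHn] x y xy; rewrite mdist_shift.
  by rewrite xy lerDl mulr_ge0 ?mdist_ge0// ltW.
rewrite exprS -[leLHS]add0r lerD// (ler_wpM2l (ltW theta_gt0))//; exact: IHn.
Qed.

Definition cylinder (w : nat -> 'I_N) (n : nat) : set S :=
  [set x | forall i, (i < n)%N -> x i = w i].

Lemma open_cylinder w n : open (cylinder w n).
Proof.
rewrite openE => x wx; apply/nbhs_ballP; exists (theta ^+ n) => /=.
  by rewrite exprn_gt0.
move=> y; rewrite ballEmdist /= => xy i ni; rewrite -wx//.
apply/esym/eqP; apply: contraTT xy => /mdist_disagree xy.
rewrite -leNgt (le_trans _ xy)// ler_wiXn2l ?(ltW theta_gt0) ?(ltW theta_lt1) ?(ltnW ni)//.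
Qed.

Lemma cylinder_small (e : R) : 0 < e -> exists n, forall x y,
  cylinder x n y -> mdist x y < e.
Proof.
move=> e0.
have : (fun n => theta ^+ n / (1 - theta)) @ \oo --> (0 : R).
  rewrite -(mul0r (1 - theta)^-1); apply: cvgMl; apply: cvg_expr.
  by rewrite ger0_norm// ltW.
move=> /cvgrPdist_lt /(_ _ e0)[n _ /(_ n (leqnn _))/=].
rewrite sub0r normrN => ne; exists n => x y xy.
apply: le_lt_trans (le_lt_trans (ler_norm _) ne).
by apply: mdist_agree => i ni; rewrite xy.
Qed.

Lemma nbhs_cylinder x (U : set S) : nbhs x U -> exists n, cylinder x n `<=` U.
Proof.
move=> /nbhs_ballP[e /= e0 xU]; have [n ne] := cylinder_small e0.
by exists n => y /ne xy; apply: xU; rewrite ballEmdist.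
Qed.

Definition cylinders :=
  [set cylinder w n.+1 | w in [set: nat -> 'I_N] & n in [set: nat]].

Lemma countable_cylinders : countable cylinders.
Proof.
pose i0 := Ordinal (aperiodic_size hA).
apply: (@sub_countable _ _ _ (range (fun s : seq 'I_N => cylinder (nth i0 s) (size s)))).
  apply: subset_card_le => _ [w _ [n _ <-]].
  exists (mkseq w n.+1) => //; rewrite size_mkseq; apply/seteqP.
  by split => x wx i ni; rewrite wx// nth_mkseq.
by apply: sub_countable (card_image_le _ _) _; exact: countableP.
Qed.

Lemma cylinders_basis : basis cylinders.
Proof.
split; first by move=> _ [w _ [n _ <-]]; exact: open_cylinder.
move=> x U /nbhs_cylinder[n xU]; exists (cylinder x n.+1).
  by split => //; exists (x : nat -> 'I_N) => //; exists n.
by move=> y xy; apply: xU => i ni; apply: xy; exact: ltnW.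
Qed.

Lemma second_countable_sft : @second_countable S.
Proof. by exists cylinders; [exact: countable_cylinders|exact: cylinders_basis]. Qed.

Lemma cylinder_measurable w n : measurable (cylinder w n : set (borel S)).
Proof. by apply: sub_sigma_algebra; exact: open_cylinder. Qed.

Lemma cylinders_setI_closed : setI_closed (cylinders `|` [set set0]).
Proof.
move=> C D [[w _ [n _ <-]]|->]; last by rewrite set0I; right.
move=> [[v _ [k _ <-]]|->]; last by rewrite setI0; right.
have [->|/set0P[x [wx vx]]] := eqVneq (cylinder w n.+1 `&` cylinder v k.+1) set0.
  by right.
left; exists (x : nat -> 'I_N) => //; exists (maxn n k) => //.
apply/seteqP; split => [y xy|y [wy vy] i].
  split => i ik.
    by rewrite xy; [exact: wx|rewrite (leq_trans ik)// ltnS leq_maxl].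
  by rewrite xy; [exact: vx|rewrite (leq_trans ik)// ltnS leq_maxr].
rewrite ltnS leq_max => /orP[ik|ik]; first by rewrite wy// wx.
by rewrite vy// vx.
Qed.

Lemma measurable_cylinders :
  (measurable : set (set (borel S))) = <<s cylinders `|` [set set0] >>.
Proof.
apply/seteqP; split; last first.
  apply: smallest_sub; first exact: sigma_algebra_measurable.
  by move=> _ [[w _ [n _ <-]]|->//]; exact: cylinder_measurable.
apply: smallest_sub; first exact: smallest_sigma_algebra.
move=> U oU.
pose I := [set C | cylinders C /\ C `<=` U].
have -> : U = \bigcup_(C in I) C.
  apply/seteqP; split => [x Ux|x [C [_ CU]]]; last exact: CU.
  have : nbhs x U by exact: open_nbhs_nbhs.
  by move=> /(cylinders_basis.2 x)[C [CC Cx] CU]; exists C.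
rewrite bigcup_set_type.
apply: (@countable_bigcupT_measurable _
    (g_sigma_algebraType (cylinders `|` [set set0]))).
  have : countable I.
    by apply: sub_countable countable_cylinders; apply: subset_card_le => C [].
  by rewrite -(eq_countable (card_setT _)).
by move=> [C /= /set_mem[/= cC _]]; apply: sub_sigma_algebra; left.
Qed.

(** Nonempty words give a pi-system generating the Borel sets; the cylinders
    of the single letters cover the space. *)
Lemma cylinder_measure_unique (m1 m2 : {measure set (borel S) -> \bar R}) :
  (m1 setT < +oo)%E ->
  (forall w n, m1 (cylinder w n.+1) = m2 (cylinder w n.+1)) ->
  forall E, measurable E -> m1 E = m2 E.
Proof.
move=> m1oo m12 E mE.
pose g k := cylinder (fun=> nth (Ordinal (aperiodic_size hA)) (enum 'I_N) k) 1.
apply: (@measure_unique _ R (borel S) _ g measurable_cylinders) => //.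
- exact: cylinders_setI_closed.
- move=> k; left; exists (fun=> nth (Ordinal (aperiodic_size hA)) (enum 'I_N) k) => //.
  by exists 0%N.
- apply/seteqP; split => // x _.
  exists (index (x 0%N) (enum 'I_N)) => // -[|//] _ /=.
  by rewrite nth_index// mem_enum.
- by move=> _ [[w _ [n _ <-]]|->]; rewrite ?measure0.
- move=> k; apply: le_lt_trans m1oo; rewrite le_measure ?inE//.
  exact: cylinder_measurable.
Qed.

End subshift_metric.

(** * The transfer operator of a Markov measure *)

(** The witnesses [P] and [p] are parameters, since the transfer operator is
    defined from them. *)
Record markov_data (R : realType) (N : nat) (A : 'M[nat]_N) (theta : R)
    (hA : aperiodic A) (theta01 : 0 < theta < 1)
    (m : probability (borel (sft hA theta01)) R)
    (P : 'M[R]_N) (p : 'rV[R]_N) : Prop := MarkovData {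
  transition_ge0 : forall i j, 0 <= P i j ;
  transition_gt0 : forall i j, 0 < P i j <-> A i j = 1%N ;
  stationary_ge0 : forall i, 0 <= p 0 i ;
  stationary_sum1 : \sum_i p 0 i = 1 ;
  stationaryP : p *m P = p ;
  cylinder_measure : forall (w : nat -> 'I_N) (n : nat),
    m (cylinder w n.+1 : set (sft hA theta01)) =
    (p 0 (w 0%N) * \prod_(i < n) P (w i) (w i.+1))%:E
}.

Section markov_transfer.
Context (R : realType) (N : nat) (A : 'M[nat]_N) (theta : R).
Context (hA : aperiodic A) (theta01 : 0 < theta < 1).
Local Notation S := (sft hA theta01).
Local Notation sigma := (@Defs.shift N R A theta hA theta01).
Local Notation cyl := (@cylinder R N A theta hA theta01).
Context (m : probability (borel S) R) (P : 'M[R]_N) (p : 'rV[R]_N).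
Hypothesis mP : markov_data m P p.
Implicit Types (x y : S) (phi : S -> R).

Let theta_gt0 : 0 < theta. Proof. by case/andP: theta01. Qed.
Let theta_lt1 : theta < 1. Proof. by case/andP: theta01. Qed.

Let P_ge0 := transition_ge0 mP.
Let P_gt0 := transition_gt0 mP.
Let p_ge0 := stationary_ge0 mP.
Let p_sum1 := stationary_sum1 mP.
Let p_stationary := stationaryP mP.

Lemma inadmissible_weight i j : A i j <> 1%N -> P i j = 0.
Proof.
move=> Aij; apply/eqP; rewrite eq_le P_ge0 andbT leNgt.
by apply/negP => /P_gt0.
Qed.

(** Some letter has positive mass, and a positive power of the transition
    matrix spreads it to all letters. *)
Lemma stationary_gt0 i : 0 < p 0 i.
Proof.
have [k k0] : exists k, 0 < p 0 k.
  apply: contrapT => /forallNP pk; have := oner_neq0 R; rewrite -p_sum1.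
  rewrite big1 ?eqxx// => k _; apply/eqP; rewrite eq_le p_ge0 andbT leNgt.
  exact/negP/pk.
have [n _ /(_ k i) Aki] := aperiodic_power hA.
have P_exp_ge0 l a b : 0 <= (P ^+ l) a b.
  elim: l a b => [|l IHl] a b; first by rewrite expr0 mxE; case: (_ == _).
  by rewrite exprS mxE sumr_ge0// => c _; rewrite mulr_ge0.
have Pki : 0 < (P ^+ n) k i.
  elim: n k Aki {k0} => [|n IHn] k.
    by rewrite !expr0 !mxE; case: (_ == _).
  rewrite !exprS !mxE lt0n => /negP nz.
  have [c Ac] : exists c, (0 < A k c * (A ^+ n) c i)%N.
    apply: contrapT => noc; apply: nz; apply/eqP; apply: big1 => c _.
    by apply/eqP; rewrite -leqn0 leqNgt; apply/negP => ?; apply: noc; exists c.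
  move: Ac; rewrite muln_gt0 => /andP[Akc Aci].
  have {}Akc : A k c = 1%N by apply/eqP; rewrite eqn_leq Akc (aperiodic_entry hA).
  apply: lt_le_trans (_ : P k c * (P ^+ n) c i <= _).
    by rewrite mulr_gt0//; [exact/P_gt0|exact: IHn].
  rewrite [leRHS](bigD1 c)//= lerDl sumr_ge0// => b _.
  by rewrite mulr_ge0.
have pn : p *m (P ^+ n) = p.
  elim: (n) => [|l IHl]; first by rewrite expr0 mulmx1.
  by rewrite exprS mulmxA p_stationary.
rewrite -pn mxE; apply: lt_le_trans (_ : p 0 k * (P ^+ n) k i <= _).
  by rewrite mulr_gt0.
by rewrite [leRHS](bigD1 k)//= lerDl sumr_ge0// => b _; rewrite mulr_ge0.
Qed.

Lemma cylinder_measure_gt0 x n : (0 < m (cyl x n))%E.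
Proof.
case: n => [|n].
  rewrite (_ : cyl _ _ = setT) ?probability_setT ?lte01//.
  by apply/seteqP; split.
rewrite (cylinder_measure mP) lte_fin mulr_gt0 ?stationary_gt0// prodr_gt0// => i _.
by apply/P_gt0; exact: sft_admissible.
Qed.

(** [m] has full support: a property true almost everywhere holds on a dense
    set. *)
Lemma ae_cylinder (Q : S -> Prop) : {ae m, forall x, Q x} ->
  forall x (e : R), 0 < e -> exists2 y, mdist x y < e & Q y.
Proof.
move=> [Z [mZ Z0 QZ]] x e e0; have [n ne] := cylinder_small hA theta01 e0.
apply: contrapT => noy; have := cylinder_measure_gt0 x n.
suff : (m (cyl x n) <= m Z)%E by rewrite Z0 => /le_lt_trans h /h; rewrite ltxx.
rewrite le_measure ?inE//; first exact: cylinder_measurable.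
move=> y xy; apply: QZ => /= Qy; apply: noy; exists y => //; exact: ne.
Qed.

Definition cons_seq (i : 'I_N) (w : nat -> 'I_N) n := if n is k.+1 then w k else i.

Lemma cons_admissible i x : A i (x 0%N) = 1%N ->
  forall n, A (cons_seq i x n) (cons_seq i x n.+1) = 1%N.
Proof. by move=> ix [|n] //=; exact: sft_admissible. Qed.

(** The value [x] when [i] cannot precede [x] is arbitrary: the weight of [i]
    vanishes there. *)
Definition cons i x : S :=
  if pselect (A i (x 0%N) = 1%N) is left ix then
    Sft hA theta01 (cons_admissible ix)
  else x.

Lemma cons0 i x : A i (x 0%N) = 1%N -> cons i x 0%N = i.
Proof. by rewrite /cons; case: pselect. Qed.

Lemma shift_cons i x : A i (x 0%N) = 1%N -> sigma (cons i x) = x.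
Proof. by rewrite /cons; case: pselect => // ? _; exact: sft_inj. Qed.

Lemma cons_shift x : cons (x 0%N) (sigma x) = x.
Proof.
rewrite /cons; case: pselect => [?|]; last by case; exact: sft_admissible x 0%N.
by apply: sft_inj; apply/funext => -[].
Qed.

Lemma mdist_cons_admissible i x y : A i (x 0%N) = 1%N -> x 0%N = y 0%N ->
  mdist (cons i x) (cons i y) = theta * mdist x y.
Proof.
by move=> ix xy; rewrite mdist_shift !cons0 -?xy// eqxx add0r !shift_cons -?xy.
Qed.

Lemma cons_inadmissible i x : A i (x 0%N) <> 1%N -> cons i x = x.
Proof. by rewrite /cons; case: pselect. Qed.

(** Words with different first letters are at distance at least [1], and the
    diameter is at most [(1 - theta)^-1]; this covers the jumps of [cons i]. *)
Lemma mdist_cons i x y : mdist (cons i x) (cons i y) <= (1 - theta)^-1 * mdist x y.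
Proof.
have th : 0 < 1 - theta by rewrite subr_gt0.
have th1 : 1 <= (1 - theta)^-1 by rewrite invf_ge1// lerBlDr lerDl ltW.
have [xy|/mdist_disagree xy] := eqVneq (x 0%N) (y 0%N); last first.
  rewrite expr0 in xy; rewrite (le_trans (mdist_sft_le _ _))//.
  by rewrite ler_peMr// invr_ge0 ltW.
apply: (@le_trans _ _ (mdist x y)); last by rewrite ler_peMl ?mdist_ge0.
have [ix|nix] := pselect (A i (x 0%N) = 1%N); last first.
  by rewrite !cons_inadmissible// -xy.
by rewrite mdist_cons_admissible// ler_piMl ?mdist_ge0// ltW.
Qed.

(** The backward transition probability: the conditional probability that the
    letter before [x] is [i]. *)
Definition weight i x := p 0 i * P i (x 0%N) / p 0 (x 0%N).

Lemma weight_ge0 i x : 0 <= weight i x.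
Proof. by rewrite /weight !mulr_ge0// invr_ge0. Qed.

Lemma weight_sum1 x : \sum_i weight i x = 1.
Proof.
rewrite /weight -mulr_suml; have := stationary_gt0 (x 0%N).
have /matrixP/(_ 0 (x 0%N)) := p_stationary; rewrite mxE => -> px.
by rewrite divff// gt_eqF.
Qed.

Lemma weight_le1 i x : weight i x <= 1.
Proof.
rewrite -(weight_sum1 x) (bigD1 i)//= lerDl sumr_ge0// => k _.
exact: weight_ge0.
Qed.

Lemma weight_inadmissible i x : A i (x 0%N) <> 1%N -> weight i x = 0.
Proof. by move=> /inadmissible_weight; rewrite /weight => ->; rewrite mulr0 mul0r. Qed.

Definition transfer phi x := \sum_i weight i x * phi (cons i x).

Lemma transfer_le phi psi : (forall x, phi x <= psi x) ->
  forall x, transfer phi x <= transfer psi x.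
Proof. by move=> le x; apply: ler_sum => i _; rewrite ler_wpM2l// weight_ge0. Qed.

Lemma transfer_cst (c : R) x : transfer (fun=> c) x = c.
Proof. by rewrite /transfer -mulr_suml weight_sum1 mul1r. Qed.

Lemma transferM phi psi x :
  transfer (fun y => phi (sigma y) * psi y) x = phi x * transfer psi x.
Proof.
rewrite /transfer mulr_sumr; apply: eq_bigr => i _.
have [ix|/weight_inadmissible ->] := pselect (A i (x 0%N) = 1%N).
  by rewrite shift_cons// mulrCA.
by rewrite !mul0r mulr0.
Qed.

Lemma transferB phi psi x :
  transfer (fun y => phi y - psi y) x = transfer phi x - transfer psi x.
Proof. by rewrite /transfer -sumrB; apply: eq_bigr => i _; rewrite mulrBr. Qed.

Lemma transfer_bound phi (c : R) : (forall x, `|phi x| <= c) ->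
  forall x, `|transfer phi x| <= c.
Proof.
move=> phic x; rewrite ler_norml -[X in _ <= _ <= X](transfer_cst c x).
rewrite -[X in X <= _](transfer_cst (- c) x).
by apply/andP; split; apply: transfer_le => y; have := phic y; rewrite ler_norml => /andP[].
Qed.

(** On points with the same first letter the weights agree and [cons] contracts
    by [theta]; otherwise the points are at distance at least [1] and the
    supremum bound is enough. *)
Lemma transfer_lipschitz phi (c C : R) : 0 <= C ->
  (forall x, `|phi x| <= c) -> (forall x y, `|phi x - phi y| <= C * mdist x y) ->
  forall x y, `|transfer phi x - transfer phi y| <= (theta * C + 2 * c) * mdist x y.
Proof.
move=> C0 phic phiC x y.
have c0 : 0 <= c by rewrite (le_trans _ (phic x)).
have [xy|xy] := eqVneq (x 0%N) (y 0%N); last first.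
  have xy1 := mdist_disagree xy; rewrite expr0 in xy1.
  rewrite (le_trans (ler_normB _ _))//.
  have := transfer_bound phic x; have := transfer_bound phic y.
  have := mulr_ge0 (mulr_ge0 (ltW theta_gt0) C0) (mdist_ge0 x y).
  have : 2 * c * 1 <= 2 * c * mdist x y by rewrite ler_wpM2l// mulr_ge0.
  by rewrite mulrDl; lra.
rewrite /transfer -sumrB (le_trans (ler_norm_sum _ _ _))//.
apply: (@le_trans _ _ (\sum_i weight i x * (theta * C * mdist x y))).
  apply: ler_sum => i _; rewrite {2}/weight -xy -/(weight i x) -mulrBr normrM.
  rewrite ger0_norm ?weight_ge0//.
  have [ix|/weight_inadmissible ->] := pselect (A i (x 0%N) = 1%N); last by rewrite !mul0r.
  rewrite ler_wpM2l ?weight_ge0// (le_trans (phiC _ _))//.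
  by rewrite mdist_cons_admissible// mulrCA mulrA.
rewrite -mulr_suml weight_sum1 mul1r ler_wpM2r ?mdist_ge0//.
by rewrite lerDl mulr_ge0.
Qed.

Lemma iter_transfer_bound n phi (c : R) : (forall x, `|phi x| <= c) ->
  forall x, `|iter n transfer phi x| <= c.
Proof. by elim: n => // n IHn phic; exact/transfer_bound/IHn. Qed.

(** Summing the geometric series of the remainders [2 c]. *)
Lemma iter_transfer_lipschitz n phi (c C : R) : 0 <= C ->
  (forall x, `|phi x| <= c) -> (forall x y, `|phi x - phi y| <= C * mdist x y) ->
  forall x y, `|iter n transfer phi x - iter n transfer phi y| <=
    (theta ^+ n * C + 2 * c / (1 - theta)) * mdist x y.
Proof.
move=> C0 phic phiC.
have c0 : 0 <= c by rewrite (le_trans _ (phic point)).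
have th : 0 < 1 - theta by rewrite subr_gt0.
elim: n => [|n IHn] x y.
  rewrite (le_trans (phiC _ _))// ler_wpM2r ?mdist_ge0// expr0 mul1r lerDl.
  by rewrite divr_ge0 ?mulr_ge0// ltW.
have D0 : 0 <= theta ^+ n * C + 2 * c / (1 - theta).
  by rewrite addr_ge0 ?mulr_ge0 ?exprn_ge0 ?invr_ge0// ltW.
rewrite !iterS.
apply: le_trans (transfer_lipschitz D0 (iter_transfer_bound n phic) IHn x y) _.
rewrite ler_wpM2r ?mdist_ge0// exprS le_eqVlt; apply/orP; left; apply/eqP.
by field; rewrite gt_eqF.
Qed.

Let weight_measurable i : measurable_fun [set: borel S] (weight i).
Proof.
apply: (lipschitz_fun_measurable (X := S)).
exists 1 => x y; rewrite mul1r.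
have [xy|/mdist_disagree] := eqVneq (x 0%N) (y 0%N).
  by rewrite /weight xy subrr normr0 mdist_ge0.
rewrite expr0; apply: le_trans; rewrite ler_norml.
have := weight_le1 i x; have := weight_le1 i y.
by have := weight_ge0 i x; have := weight_ge0 i y; lra.
Qed.

Let first (i : 'I_N) x : R := (x 0%N == i)%:R.

Let first_ge0 i x : 0 <= first i x.
Proof. by rewrite /first; case: (_ == _). Qed.

Let first_measurable i : measurable_fun [set: borel S] (first i).
Proof.
apply: (lipschitz_fun_measurable (X := S)).
exists 1 => x y; rewrite mul1r.
have [xy|/mdist_disagree] := eqVneq (x 0%N) (y 0%N).
  by rewrite /first xy subrr normr0 mdist_ge0.
rewrite expr0; apply: le_trans; rewrite /first.
by case: (_ == _); case: (_ == _); rewrite ?subrr ?subr0 ?sub0r ?normrN ?normr1 ?normr0.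
Qed.

Lemma measurable_shift : measurable_fun [set: borel S] (sigma : borel S -> borel S).
Proof.
apply: (lipschitz_map_measurable (X := S) (Y := S) (g := sigma) (C := theta^-1)).
exact: mdist_shift_le.
Qed.

Lemma measurable_cons i : measurable_fun [set: borel S] (cons i : borel S -> borel S).
Proof.
apply: (lipschitz_map_measurable (X := S) (Y := S) (g := cons i)).
exact: mdist_cons.
Qed.

Let first_mass (i : 'I_N) : {measure set (borel S) -> \bar R} :=
  density_measure m (first_measurable i) (first_ge0 i).

Let shifted_mass (i : 'I_N) : {measure set (borel S) -> \bar R}.
Proof.
by refine (pushforward (first_mass i) (sigma : borel S -> borel S));
  exact: measurable_shift.
Defined.

Let weight_mass (i : 'I_N) : {measure set (borel S) -> \bar R} :=
  density_measure m (weight_measurable i) (weight_ge0 i).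

(** The identity [p_i P_ij = (p_i P_ij / p_j) p_j] on cylinders: restricting [m]
    to the words starting with [i] and dropping this letter gives [m] with the
    density [weight i]. *)
Let shift_weight i C : measurable C -> weight_mass i C = shifted_mass i C.
Proof.
apply: cylinder_measure_unique => [|w n].
  rewrite -[X in (X < _)%E]/(\int[m]_x (weight i x)%:E)%E.
  apply: (@le_lt_trans _ _ (\int[m]_x (cst 1%:E x))%E).
    apply: ge0_le_integral => //.
    - by move=> x _; rewrite lee_fin weight_ge0.
    - exact/measurable_EFinP.
    - by move=> x _; rewrite lee_fin weight_le1.
  by rewrite integral_cst// mul1e (le_lt_trans (probability_le1 m measurableT)) ?ltry.
rewrite -[LHS]/(\int[m]_(x in cyl w n.+1) (weight i x)%:E)%E.
rewrite -[RHS]/(\int[m]_(x in sigma @^-1` (cyl w n.+1)) (first i x)%:E)%E.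
transitivity ((p 0 i * P i (w 0%N) / p 0 (w 0%N))%:E * m (cyl w n.+1))%E.
  rewrite -integral_cst//; last exact: cylinder_measurable.
  by apply: eq_integral => x /set_mem/(_ 0%N (ltn0Sn _)) x0; rewrite /weight x0.
transitivity (m (cyl (cons_seq i w) n.+2)).
  rewrite !(cylinder_measure mP) -EFinM big_ord_recl/=; congr EFin.
  rewrite !mulrA; congr (_ * _); rewrite mulfVK// gt_eqF// stationary_gt0//.
have mCs : measurable (sigma @^-1` (cyl w n.+1) : set (borel S)).
  rewrite -[X in measurable X]setTI; apply: measurable_shift => //.
  exact: cylinder_measurable.
have first_cyl : [set x : S | x 0%N == i] = cyl (fun=> i) 1.
  apply/seteqP; split => [x /eqP xi [|]//|x xi].
  by apply/eqP; exact: xi.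
rewrite (_ : cyl (cons_seq i w) n.+2 =
    [set x : S | x 0%N == i] `&` (sigma @^-1` (cyl w n.+1))).
  rewrite -integral_indic//; last first.
    by rewrite first_cyl; exact: cylinder_measurable.
  by apply: eq_integral => x _; rewrite indicE mem_setE.
apply/seteqP; split => [x xw|x [/eqP xi xw] [_|k /=]].
- split; first by rewrite /= xw.
  by move=> k kn; rewrite /= xw.
- by rewrite xi.
- by rewrite ltnS; exact: xw.
Qed.

(** Each inverse branch [cons i] is handled by [shift_weight]; the branches
    recombine because [cons (x 0) (sigma x) = x]. *)
Lemma transfer_adjoint phi (C : set (borel S)) : measurable C -> lipschitz_fun phi ->
  (forall x, 0 <= phi x) ->
  (\int[m]_(x in sigma @^-1` C) (phi x)%:E =
   \int[m]_(x in C) (transfer phi x)%:E)%E.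
Proof.
move=> mC [L phiL] phi0.
have mphi : measurable_fun [set: borel S] phi.
  by apply: lipschitz_fun_measurable; exists L.
have mphic i : measurable_fun [set: borel S] (phi \o cons i).
  exact: measurableT_comp (measurable_cons i).
have mphics i : measurable_fun [set: borel S] (phi \o cons i \o sigma).
  exact: (measurableT_comp (mphic i) measurable_shift).
have mCs : measurable (sigma @^-1` C : set (borel S)).
  by rewrite -[X in measurable X]setTI; exact: measurable_shift.
have branch i : (\int[m]_(x in C) (phi (cons i x) * weight i x)%:E =
    \int[m]_(x in sigma @^-1` C) (phi (cons i (sigma x)) * first i x)%:E)%E.
  transitivity (\int[weight_mass i]_(x in C) (phi (cons i x))%:E)%E.
    rewrite [RHS](ge0_integral_density (h := weight i) (m := m))//.
    - exact: weight_ge0.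
    - by apply/measurable_EFinP; exact: (measurable_funTS (mphic i)).
    - by move=> x _; rewrite lee_fin.
  transitivity (\int[shifted_mass i]_(x in C) (phi (cons i x))%:E)%E.
    by apply: eq_measure_integral => D mD _; exact: shift_weight.
  rewrite ge0_integral_pushforward//.
  - rewrite [LHS](ge0_integral_density (h := first i) (m := m))//.
    + by apply/measurable_EFinP; exact: (measurable_funTS (mphics i)).
    + by move=> x _; rewrite lee_fin.
  - exact: measurable_shift.
  - by apply/measurable_EFinP; exact: (measurable_funTS (mphic i)).
  - by move=> x _; rewrite lee_fin.
transitivity (\sum_(i < N) \int[m]_(x in C) (phi (cons i x) * weight i x)%:E)%E; last first.
  rewrite -ge0_integral_sum//.
  - by apply: eq_integral => x _; rewrite sumEFin; congr EFin; apply: eq_bigr => i _; rewrite mulrC.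
  - move=> i; apply/measurable_EFinP; apply: measurable_funTS.
    exact: (measurable_funM (mphic i)).
  - by move=> i x _; rewrite lee_fin mulr_ge0// weight_ge0.
under eq_bigr do rewrite branch.
rewrite -ge0_integral_sum//.
- apply: eq_integral => x _; rewrite sumEFin; congr EFin.
  rewrite (bigD1 (x 0%N))//= big1 ?addr0.
    by rewrite cons_shift /first eqxx mulr1.
  by move=> i ix; rewrite /first eq_sym (negbTE ix) mulr0.
- move=> i; apply/measurable_EFinP; apply: measurable_funTS.
  exact: (measurable_funM (mphics i)).
- by move=> i x _; rewrite lee_fin mulr_ge0.
Qed.

Lemma lipschitz_fun_transfer phi : lipschitz_fun phi -> lipschitz_fun (transfer phi).
Proof.
move=> phiL; have [c _ phic] := lipschitz_sft_bounded phiL.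
have [C C0 phiC] := lipschitz_fun_ge0 phiL.
by exists (theta * C + 2 * c); exact: transfer_lipschitz.
Qed.

Lemma transfer_ge0 phi : (forall x, 0 <= phi x) -> forall x, 0 <= transfer phi x.
Proof. by move=> phi0 x; rewrite sumr_ge0// => i _; rewrite mulr_ge0// weight_ge0. Qed.

Lemma iter_transfer_ge0 n phi : (forall x, 0 <= phi x) ->
  forall x, 0 <= iter n transfer phi x.
Proof. by elim: n => // n IHn phi0; exact/transfer_ge0/IHn. Qed.

Lemma measurable_iter_shift n (C : set (borel S)) : measurable C ->
  measurable (iter n sigma @^-1` C : set (borel S)).
Proof.
move=> mC; elim: n => [//|n IHn].
rewrite (_ : _ @^-1` C = sigma @^-1` (iter n sigma @^-1` C)).
  by rewrite -[X in measurable X]setTI; exact: measurable_shift.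
by apply/funext => x /=; rewrite -iterS iterSr.
Qed.

Lemma iter_transfer_adjoint n phi (C : set (borel S)) : measurable C ->
  lipschitz_fun phi -> (forall x, 0 <= phi x) ->
  (\int[m]_(x in iter n sigma @^-1` C) (phi x)%:E =
   \int[m]_(x in C) (iter n transfer phi x)%:E)%E.
Proof.
move=> mC; elim: n phi => [//|n IHn] phi phiL phi0.
rewrite (_ : iter n.+1 sigma @^-1` C = sigma @^-1` (iter n sigma @^-1` C)); last first.
  by apply/funext => x /=; rewrite -iterS iterSr.
have mnC := measurable_iter_shift n mC.
rewrite transfer_adjoint// IHn ?iterSr//.
- exact: lipschitz_fun_transfer.
- exact: transfer_ge0.
Qed.

Lemma iter_transferB n phi psi x :
  iter n transfer (fun y => phi y - psi y) x =
  iter n transfer phi x - iter n transfer psi x.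
Proof.
elim: n x => // n IHn x; rewrite !iterS -transferB; congr (transfer _ x).
by apply/funext => y; rewrite IHn.
Qed.

(** The points of coincidence are dense by full support, and both functions are
    continuous. *)
Lemma ae_eq_lipschitz phi psi : lipschitz_fun phi -> lipschitz_fun psi ->
  {ae m, forall x, phi x = psi x} -> phi = psi.
Proof.
move=> /lipschitz_fun_ge0[C C0 phiC] /lipschitz_fun_ge0[D D0 psiD] ae_eq.
apply/funext => x; apply/eqP; rewrite -subr_eq0 -normr_le0.
apply/ler_addgt0Pr => e e0; rewrite add0r.
have CD : 0 < C + D + 1 by rewrite ltr_wpDl// addr_ge0.
have [y xy phipsi] := ae_cylinder ae_eq x (divr_gt0 e0 CD).
rewrite ltr_pdivlMr// mulrC in xy.
rewrite (_ : phi x - psi x = (phi x - phi y) - (psi x - psi y)).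
  rewrite (le_trans (ler_normB _ _))//; have := phiC x y; have := psiD x y.
  have := mdist_ge0 x y; rewrite !mulrDl mul1r in xy; lra.
by rewrite phipsi; ring.
Qed.

End markov_transfer.

(** * Geometric limits *)

Section real_limits.
Context {R : realType}.

Lemma geometric_small (a c e : R) : 0 < a < 1 -> 0 < e ->
  exists n, c * a ^+ n < e.
Proof.
move=> /andP[a0 a1] e0.
have : (fun n => c * a ^+ n) @ \oo --> (0 : R).
  rewrite -(mulr0 c); apply: cvgMr; apply: cvg_expr.
  by rewrite ger0_norm// ltW.
move=> /cvgrPdist_lt /(_ _ e0)[n _ /(_ n (leqnn _))/=].
rewrite sub0r normrN => ne; exists n.
exact: le_lt_trans (ler_norm _) ne.
Qed.

(** Both [u n - c a^n] and [- (u n + c a^n)] are nondecreasing, so every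
    lower estimate lies below every upper estimate. *)
Lemma geometric_cauchy (a c : R) (u : nat -> R) : 0 < a < 1 ->
  (forall n, `|u n.+1 - u n| <= c * (1 - a) * a ^+ n) ->
  exists l, forall n, `|u n - l| <= c * a ^+ n.
Proof.
move=> /andP[a0 a1] uc.
have lo n k : u n - c * a ^+ n <= u (n + k)%N - c * a ^+ (n + k).
  elim: k => [|k IHk]; first by rewrite addn0.
  apply: (le_trans IHk); rewrite addnS exprS.
  by have := uc (n + k)%N; rewrite ler_norml => /andP[+ _]; nra.
have up n k : u (n + k)%N + c * a ^+ (n + k) <= u n + c * a ^+ n.
  elim: k => [|k IHk]; first by rewrite addn0.
  apply: le_trans IHk; rewrite addnS exprS.
  by have := uc (n + k)%N; rewrite ler_norml => /andP[_ +]; nra.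
have c0 : 0 <= c.
  have := le_trans (normr_ge0 _) (uc 0%N); rewrite expr0 mulr1.
  by rewrite pmulr_lge0// subr_gt0.
have lu n k : u n - c * a ^+ n <= u k + c * a ^+ k.
  apply: le_trans (lo n k) (le_trans _ (up k n)); rewrite addnC.
  have : 0 <= c * a ^+ (k + n) by rewrite mulr_ge0// exprn_ge0// ltW.
  lra.
pose L := [set u n - c * a ^+ n | n in [set: nat]].
have supL : has_sup L.
  split; first by exists (u 0%N - c * a ^+ 0), 0%N.
  by exists (u 0%N + c * a ^+ 0) => _ [n _ <-].
exists (sup L) => n; rewrite ler_distl; apply/andP; split.
  by rewrite lerBlDr; apply: ge_sup; [case: supL|move=> _ [k _ <-]; exact: lu].
by rewrite -lerBlDr; apply: ub_le_sup; [case: supL|exists n].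
Qed.

Lemma lee_geometric (a c : R) (x y : \bar R) : 0 < a < 1 ->
  (forall n, (x <= y + (c * a ^+ n)%:E)%E) -> (x <= y)%E.
Proof.
move=> a01 xy; apply/lee_addgt0Pr => e e0.
have [n ne] := geometric_small c a01 e0.
by apply: le_trans (xy n) _; rewrite leeD2l// lee_fin ltW.
Qed.

Lemma ler_geometric (a c x y : R) : 0 < a < 1 ->
  (forall n, x <= y + c * a ^+ n) -> x <= y.
Proof.
by move=> a01 xy; rewrite -lee_fin; apply: (lee_geometric (c := c) a01) => n;
  rewrite -EFinD lee_fin.
Qed.

Lemma ge0_le_integral_cst d (T : measurableType d) (P : probability T R)
    (D : set T) (f g : T -> R) (c : R) : measurable D ->
    measurable_fun [set: T] f -> measurable_fun [set: T] g ->
    (forall x, 0 <= f x) -> (forall x, 0 <= g x) -> 0 <= c ->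
    (forall x, f x <= g x + c) ->
  (\int[P]_(x in D) (f x)%:E <= \int[P]_(x in D) (g x)%:E + c%:E)%E.
Proof.
move=> mD mf mg f0 g0 c0 fg.
apply: (@le_trans _ _ (\int[P]_(x in D) ((g x)%:E + c%:E))%E).
  apply: ge0_le_integral => //.
  - by move=> x _; rewrite lee_fin.
  - by apply/measurable_EFinP; exact: measurable_funTS.
  - apply: emeasurable_funD => //.
    by apply/measurable_EFinP; exact: measurable_funTS.
  - by move=> x _; rewrite -EFinD lee_fin.
rewrite ge0_integralD//.
- rewrite leeD2l// integral_cst// -[leRHS]mule1 lee_wpmul2l ?lee_fin//.
  exact: probability_le1.
- by move=> x _; rewrite lee_fin.
- by apply/measurable_EFinP; exact: measurable_funTS.
Qed.

End real_limits.

(** * The leafwise averages of a Lipschitz function *)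

Section invariant_density.
Context (R : realType) (N : nat) (A : 'M[nat]_N) (theta : R).
Context (hA : aperiodic A) (theta01 : 0 < theta < 1).
Local Notation S := (sft hA theta01).
Local Notation sigma := (@Defs.shift N R A theta hA theta01).
Context (m : probability (borel S) R) (P : 'M[R]_N) (p : 'rV[R]_N).
Hypothesis mP : markov_data m P p.
Context (K : pmetricType R) (G : S * K -> K).
Local Notation Sigma := (borel S * borel K)%type.
Hypothesis K_second_countable : @second_countable K.
Hypothesis K_diam : forall y1 y2 : K, mdist y1 y2 <= 1.
Hypothesis mG : measurable_fun [set: Sigma] (G : Sigma -> borel K).
Variables (alpha H : R).
Hypothesis alpha01 : 0 < alpha < 1.
Hypothesis G_ae_contracting : {ae m, forall x, forall y1 y2 : K,
  mdist (G (x, y1)) (G (x, y2)) <= alpha * mdist y1 y2}.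
Hypothesis H_ge0 : 0 <= H.
Hypothesis G_base_lipschitz : forall (y : K) (x1 x2 : S),
  mdist (G (x1, y)) (G (x2, y)) <= H * mdist x1 x2.
Variable mu0 : probability Sigma R.
Hypothesis mu0_invariant : forall E : set Sigma, measurable E ->
  mu0 (skew_product G @^-1` E) = mu0 E.
Variable rho : S -> R.
Hypothesis rho_lipschitz : lipschitz_fun rho.
Hypothesis rho_ge0 : forall x, 0 <= rho x.
Hypothesis mu0_marginal : forall C : set (borel S), measurable C ->
  mu0 (fst @^-1` C) = (\int[m]_(x in C) (rho x)%:E)%E.

Let theta_gt0 : 0 < theta. Proof. by case/andP: theta01. Qed.
Let theta_lt1 : theta < 1. Proof. by case/andP: theta01. Qed.
Let alpha_gt0 : 0 < alpha. Proof. by case/andP: alpha01. Qed.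
Let alpha_lt1 : alpha < 1. Proof. by case/andP: alpha01. Qed.
Local Notation F := (skew_product G).
Local Notation T := (transfer P p).

(** Approximate [x] by a point where the contraction holds, at the cost of two
    applications of the Lipschitz bound in the base. *)
Lemma contracting_everywhere x y1 y2 :
  mdist (G (x, y1)) (G (x, y2)) <= alpha * mdist y1 y2.
Proof.
apply/ler_addgt0Pr => e e0.
have H1 : 0 < 2 * H + 1 by rewrite ltr_wpDl// mulr_ge0.
have [x' xx' ax'] := ae_cylinder mP G_ae_contracting x (divr_gt0 e0 H1).
rewrite ltr_pdivlMr// mulrC in xx'.
have := metric_triangle (G (x, y1)) (G (x', y1)) (G (x, y2)).
have := metric_triangle (G (x', y1)) (G (x', y2)) (G (x, y2)).
have := G_base_lipschitz y1 x x'; have := G_base_lipschitz y2 x' x.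
rewrite (metric_sym x' x); have := ax' y1 y2; have := mdist_ge0 x x'.
lra.
Qed.

Let measurable_F : measurable_fun [set: Sigma] (F : Sigma -> Sigma).
Proof.
apply: measurable_fun_pair; last exact: mG.
exact: (measurableT_comp (@measurable_shift _ _ _ _ hA theta01) measurable_fst).
Qed.

Let measurable_iter_F n : measurable_fun [set: Sigma] (iter n F : Sigma -> Sigma).
Proof.
elim: n => [|n IHn]; first exact: measurable_id.
exact: (measurableT_comp measurable_F IHn).
Qed.

Let iter_F_invariant n (E : set Sigma) : measurable E ->
  mu0 (iter n F @^-1` E) = mu0 E.
Proof.
move=> mE; elim: n => // n IHn.
rewrite (_ : _ @^-1` E = F @^-1` (iter n F @^-1` E)).
  rewrite mu0_invariant//.
  by rewrite -[X in measurable X]setTI; exact: measurable_iter_F.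
by apply/funext => u /=; rewrite -iterS iterSr.
Qed.

Lemma iter_skew_product1 n u : (iter n F u).1 = iter n sigma u.1.
Proof. by elim: n => //= n ->. Qed.

Lemma iter_skew_product_contracting n x y1 y2 :
  mdist (iter n F (x, y1)).2 (iter n F (x, y2)).2 <= alpha ^+ n.
Proof.
elim: n => [|n IHn]; first exact: K_diam.
rewrite !iterS exprS /skew_product /=.
move: (iter_skew_product1 n (x, y1)) (iter_skew_product1 n (x, y2)) IHn.
case: (iter n F (x, y1)) => a b; case: (iter n F (x, y2)) => a' b' /= -> -> IHn.
by rewrite (le_trans (contracting_everywhere _ _ _))// ler_wpM2l// ltW.
Qed.

(** One more step adds [H] times the base distance, of order [theta^-n]; the
    constant is the fixed point of the recursion [c + H = c / theta]. *)
Lemma iter_skew_product_lipschitz n y x1 x2 :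
  mdist (iter n F (x1, y)).2 (iter n F (x2, y)).2 <=
  H * theta / (1 - theta) * theta^-1 ^+ n * mdist x1 x2.
Proof.
have th : 0 < 1 - theta by rewrite subr_gt0.
elim: n => [|n IHn].
  by rewrite mdistxx !mulr_ge0 ?invr_ge0 ?mdist_ge0 ?(ltW th) ?(ltW theta_gt0).
rewrite !iterS /skew_product /=.
move: (iter_skew_product1 n (x1, y)) (iter_skew_product1 n (x2, y)) IHn.
case: (iter n F (x1, y)) => a b; case: (iter n F (x2, y)) => a' b' /= -> -> IHn.
apply: le_trans (metric_triangle _ (G (iter n sigma x1, b')) _) _.
have e1 := contracting_everywhere (iter n sigma x1) b b'.
have e2 := G_base_lipschitz b' (iter n sigma x1) (iter n sigma x2).
have e3 := mdist_iter_shift_le n x1 x2.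
have e4 : alpha * mdist b b' <= mdist b b'.
  by rewrite ler_piMl ?mdist_ge0// ltW.
have e5 := ler_wpM2l H_ge0 e3.
apply: (@le_trans _ _ (H * theta / (1 - theta) * theta^-1 ^+ n * mdist x1 x2 +
  H * (theta^-1 ^+ n * mdist x1 x2))); first lra.
rewrite exprS le_eqVlt; apply/orP; left; apply/eqP.
by field; rewrite !gt_eqF//.
Qed.

Lemma rho_integrable : m.-integrable [set: borel S] (EFin \o rho).
Proof.
apply/integrableP; split.
  by apply/measurable_EFinP; exact: (lipschitz_fun_measurable (X := S)).
under eq_integral do rewrite /= ger0_norm//.
by rewrite -mu0_marginal// ltey_eq fin_num_measure//; exact: measurable_fiber.
Qed.

(** The marginal [rho m] is invariant under the shift since [mu0] is invariant
    under the skew product, so [T rho = rho] almost everywhere by duality. *)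
Lemma transfer_rho : T rho = rho.
Proof.
apply: (ae_eq_lipschitz mP) => //; first exact: (lipschitz_fun_transfer mP).
have mlip (phi : S -> R) : lipschitz_fun phi ->
    measurable_fun [set: borel S] (EFin \o phi).
  by move=> phiL; apply/measurable_EFinP; exact: (lipschitz_fun_measurable (X := S)).
have : ae_eq m setT (EFin \o rho) (EFin \o T rho).
  apply: integral_ae_eq => //.
  - exact: rho_integrable.
  - by apply: mlip; exact: (lipschitz_fun_transfer mP).
  - move=> C _ mC; rewrite -[RHS](transfer_adjoint mP)//.
    have mCs : measurable (sigma @^-1` C : set (borel S)).
      by rewrite -[X in measurable X]setTI; exact: measurable_shift.
    rewrite -!mu0_marginal// -[LHS]mu0_invariant//.
    exact: measurable_fiber.
by apply: ae_mp => x /(_ I)[].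
Qed.

Let marginal : {measure set (borel S) -> \bar R}.
Proof. by refine (pushforward mu0 fst); exact: measurable_fst. Defined.

Section observable.
Variables (f : S * K -> R) (L M : R).
Hypothesis f_ge0 : forall u, 0 <= f u.
Hypothesis f_le : forall u, f u <= M.
Hypothesis L_ge0 : 0 <= L.
Hypothesis f_lipschitz : forall u v,
  `|f u - f v| <= L * (mdist u.1 v.1 + mdist u.2 v.2).

Let M_ge0 : 0 <= M. Proof. exact: le_trans (f_ge0 point) (f_le _). Qed.

Let y0 : K := point.
(** By contraction, the starting height [y0] matters up to [alpha^n] only. *)
Let along n x := f (iter n F (x, y0)).

Let along_ge0 n x : 0 <= along n x. Proof. exact: f_ge0. Qed.

Let along_norm n x : `|along n x| <= M.
Proof. by rewrite ger0_norm// f_le. Qed.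

Let along_lipschitz n x1 x2 : `|along n x1 - along n x2| <=
  L * (1 + H * theta / (1 - theta)) * theta^-1 ^+ n * mdist x1 x2.
Proof.
apply: le_trans (f_lipschitz _ _) _; rewrite !iter_skew_product1 -!mulrA.
rewrite ler_wpM2l//.
have := mdist_iter_shift_le n x1 x2; have := iter_skew_product_lipschitz n y0 x1 x2.
rewrite /=; lra.
Qed.

(** The orbit of [(x, y0)] after one step starts over [sigma x], but at a
    height that is in general not [y0]. *)
Let along_step n x : `|along n.+1 x - along n (sigma x)| <= L * alpha ^+ n.
Proof.
rewrite /along iterSr; apply: le_trans (f_lipschitz _ _) _.
rewrite !iter_skew_product1 /= mdistxx add0r ler_wpM2l//.
exact: iter_skew_product_contracting.
Qed.

Let along_close n u : `|f (iter n F u) - along n u.1| <= L * alpha ^+ n.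
Proof.
case: u => x y; apply: le_trans (f_lipschitz _ _) _.
rewrite !iter_skew_product1 /= mdistxx add0r ler_wpM2l//.
exact: iter_skew_product_contracting.
Qed.

Let approx n := iter n T (fun x => along n x * rho x).

(** The product rule, the variation of [rho] being absorbed since
    [1 <= theta^-n]. *)
Let along_rho_lipschitz : exists2 D, 0 <= D & forall n x1 x2,
  `|along n x1 * rho x1 - along n x2 * rho x2| <= D * theta^-1 ^+ n * mdist x1 x2.
Proof.
have [r r0 rhor] := lipschitz_sft_bounded rho_lipschitz.
have [C C0 rhoC] := lipschitz_fun_ge0 rho_lipschitz.
set B := L * (1 + H * theta / (1 - theta)).
have B0 : 0 <= B.
  by rewrite mulr_ge0// addr_ge0// divr_ge0 ?subr_ge0 ?mulr_ge0// ltW.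
exists (B * r + M * C) => [|n x1 x2]; first by rewrite addr_ge0// mulr_ge0.
rewrite (_ : _ - _ = (along n x1 - along n x2) * rho x1 +
  along n x2 * (rho x1 - rho x2)); last by ring.
rewrite (le_trans (ler_normD _ _))// !normrM.
have t1 : 1 <= theta^-1 ^+ n by rewrite exprn_ege1// invf_ge1// ltW.
have d0 := mdist_ge0 x1 x2.
have e1 : `|along n x1 - along n x2| * `|rho x1| <=
    B * theta^-1 ^+ n * mdist x1 x2 * r.
  by rewrite ler_pM//; exact: along_lipschitz.
have e2 : `|along n x2| * `|rho x1 - rho x2| <= M * (C * mdist x1 x2).
  by rewrite ler_pM// along_norm.
have e3 : M * C * mdist x1 x2 * 1 <= M * C * mdist x1 x2 * theta^-1 ^+ n.
  by rewrite ler_wpM2l// !mulr_ge0.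
lra.
Qed.

(** The factor [theta^n] gained by [T^n] cancels the expansion [theta^-n]. *)
Let approx_lipschitz : exists2 D, 0 <= D & forall n x1 x2,
  `|approx n x1 - approx n x2| <= D * mdist x1 x2.
Proof.
have [r r0 rhor] := lipschitz_sft_bounded rho_lipschitz.
have [D D0 alongD] := along_rho_lipschitz.
have th : 0 < 1 - theta by rewrite subr_gt0.
exists (D + 2 * (M * r) / (1 - theta)) => [|n x1 x2].
  by rewrite addr_ge0// divr_ge0 ?mulr_ge0// ltW.
have bnd x : `|along n x * rho x| <= M * r.
  by rewrite normrM ler_pM// along_norm.
have Dn : 0 <= D * theta^-1 ^+ n by rewrite mulr_ge0// exprn_ge0// invr_ge0 ltW.
apply: le_trans (iter_transfer_lipschitz mP n Dn bnd (alongD n) x1 x2) _.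
rewrite (_ : theta ^+ n * _ = D)// mulrCA -exprMn divff ?gt_eqF// expr1n mulr1//.
Qed.

Let approx_cauchy : exists2 c, 0 <= c & forall n x,
  `|approx n.+1 x - approx n x| <= c * (1 - alpha) * alpha ^+ n.
Proof.
have [r r0 rhor] := lipschitz_sft_bounded rho_lipschitz.
have al : 0 < 1 - alpha by rewrite subr_gt0.
exists (L * r / (1 - alpha)) => [|n x]; first by rewrite divr_ge0 ?mulr_ge0// ltW.
(* [T rho = rho] allows one more application of [T] in [approx n], so that both
   terms are images under the same power of [T] *)
have -> : approx n = iter n.+1 T (fun x => along n (sigma x) * rho x).
  rewrite iterSr /approx; congr (iter n T _).
  by apply/funext => y; rewrite (transferM mP (along n)) transfer_rho.
rewrite -iter_transferB; apply: (iter_transfer_bound mP) => y.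
rewrite -mulrBl normrM mulfVK ?gt_eqF// mulrAC.
by rewrite ler_pM//; exact: along_step.
Qed.

Let mf : measurable_fun [set: Sigma] f.
Proof.
apply: (lipschitz_sum_measurable (X := S)) => //; last by exists L.
exact: second_countable_sft.
Qed.

Let measurable_along n : measurable_fun [set: borel S] (along n).
Proof. by apply: (lipschitz_fun_measurable (X := S)); eexists; exact: along_lipschitz. Qed.

Let along_rho n : lipschitz_fun (fun x => along n x * rho x).
Proof. by have [D _ alongD] := along_rho_lipschitz; eexists; exact: alongD. Qed.

Let approx_integral n (C : set (borel S)) : measurable C ->
  (\int[mu0]_(u in iter n F @^-1` (fst @^-1` C)) (along n u.1)%:E =
   \int[m]_(x in C) (approx n x)%:E)%E.
Proof.
move=> mC; rewrite -(iter_transfer_adjoint mP)//; last first.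
  by move=> x; rewrite mulr_ge0.
have mnC : measurable (iter n sigma @^-1` C : set (borel S)).
  exact: measurable_iter_shift.
have -> : iter n F @^-1` (fst @^-1` C) = fst @^-1` (iter n sigma @^-1` C).
  by apply/funext => u /=; rewrite iter_skew_product1.
transitivity (\int[marginal]_(x in iter n sigma @^-1` C) (along n x)%:E)%E.
  rewrite ge0_integral_pushforward//.
  - by apply/measurable_EFinP; exact: measurable_funTS.
  - by move=> x _; rewrite lee_fin.
rewrite (ge0_integral_density (h := rho) (m := m))//.
- exact: (lipschitz_fun_measurable (X := S)).
- by apply/measurable_EFinP; exact: measurable_funTS.
- by move=> x _; rewrite lee_fin.
Qed.

Let invariant_integral n (E : set Sigma) : measurable E ->
  (\int[mu0]_(u in E) (f u)%:E =
   \int[mu0]_(u in iter n F @^-1` E) (f (iter n F u))%:E)%E.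
Proof.
move=> mE.
rewrite -(@ge0_integral_pushforward _ _ _ _ _ _ (measurable_iter_F n) _ _ (EFin \o f))//.
- by apply: eq_measure_integral => D mD _; exact/esym/iter_F_invariant.
- by apply/measurable_EFinP; exact: measurable_funTS.
- by move=> x _; rewrite lee_fin.
Qed.

(** The limit of [approx n] is Lipschitz as they are uniformly so; by the
    invariance of [mu0], the integrals of [f] over [C x K] and of [approx n]
    over [C] differ by at most [L alpha^n]. *)
Lemma lipschitz_leafwise_average : exists psi : S -> R,
  [/\ lipschitz_fun psi, forall x, 0 <= psi x &
      forall C : set (borel S), measurable C ->
        (\int[mu0]_(u in fst @^-1` C) (f u)%:E =
         \int[m]_(x in C) (psi x)%:E)%E].
Proof.
have [c c0 approxc] := approx_cauchy.
have [D D0 approxD] := approx_lipschitz.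
have /choice[psi psiE] : forall x, exists l, forall n,
    `|approx n x - l| <= c * alpha ^+ n.
  by move=> x; apply: geometric_cauchy.
have psiL : lipschitz_fun psi.
  exists D => x y; apply: (ler_geometric (c := 2 * c) alpha01) => n.
  rewrite (_ : psi x - psi y = (approx n x - approx n y) -
    (approx n x - psi x) + (approx n y - psi y)); last by ring.
  rewrite (le_trans (ler_normD _ _))// (le_trans (lerD (ler_normB _ _) (lexx _)))//.
  by have := psiE x n; have := psiE y n; have := approxD n x y; lra.
have approx0 n x : 0 <= approx n x.
  by apply: (iter_transfer_ge0 mP) => {}x; exact: mulr_ge0.
have psi0 x : 0 <= psi x.
  apply: (ler_geometric (c := c) alpha01) => n.
  by have := psiE x n; have := approx0 n x; rewrite ler_norml => ? /andP[]; lra.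
exists psi; split => // C mC.
have mapprox n : measurable_fun [set: borel S] (approx n).
  by apply: (lipschitz_fun_measurable (X := S)); exists D; exact: approxD.
have mpsi : measurable_fun [set: borel S] psi.
  exact: (lipschitz_fun_measurable (X := S)).
have mE : measurable (fst @^-1` C : set Sigma) by exact: measurable_fiber.
have mEn n : measurable (iter n F @^-1` (fst @^-1` C) : set Sigma).
  by rewrite -[X in measurable X]setTI; exact: measurable_iter_F.
have mfn n : measurable_fun [set: Sigma] (fun u => f (iter n F u)).
  exact: (measurableT_comp mf (measurable_iter_F n)).
have man n : measurable_fun [set: Sigma] (fun u => along n u.1).
  exact: (measurableT_comp (measurable_along n) measurable_fst).
have cn n : 0 <= c * alpha ^+ n by rewrite mulr_ge0// exprn_ge0// ltW.
have Ln n : 0 <= L * alpha ^+ n by rewrite mulr_ge0// exprn_ge0// ltW.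
apply/eqP; rewrite eq_le; apply/andP; split.
  apply: (lee_geometric (c := c + L) alpha01) => n.
  rewrite (invariant_integral n)// mulrDl EFinD addeA.
  apply: le_trans (ge0_le_integral_cst mu0 (mEn n) (mfn n) (man n) _ _ (Ln n) _) _ => //.
    by move=> u; have := along_close n u; rewrite ler_norml => /andP[]; lra.
  rewrite approx_integral// leeD2r//.
  apply: ge0_le_integral_cst => // x.
  by have := psiE x n; rewrite ler_norml => /andP[]; lra.
apply: (lee_geometric (c := L + c) alpha01) => n.
rewrite (invariant_integral n)// mulrDl EFinD addeA.
apply: (@le_trans _ _ (\int[m]_(x in C) (approx n x)%:E + (c * alpha ^+ n)%:E)%E).
  apply: ge0_le_integral_cst => // x.
  by have := psiE x n; rewrite ler_norml => /andP[]; lra.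
rewrite -approx_integral// leeD2r//.
apply: ge0_le_integral_cst => // u.
by have := along_close n u; rewrite ler_norml => /andP[]; lra.
Qed.

End observable.

End invariant_density.

(** * Membership in [Sinfty] *)

Lemma ae_ge0_density d (T : measurableType d) (R : realType)
    (mu : {measure set T -> \bar R}) (g : T -> \bar R) :
  mu.-integrable [set: T] g ->
  (forall E, measurable E -> 0 <= \int[mu]_(x in E) g x)%E ->
  {ae mu, forall x, (0 <= g x)%E}.
Proof.
move=> intg g_ge0.
have mg := measurable_int _ intg.
pose Z := g @^-1` `]-oo, 0%E[.
have mZ : measurable Z by rewrite -[Z]setTI; apply: mg => //; exact: emeasurable_itv.
have : ae_eq mu Z g (cst 0%E).
  apply: integral_ae_eq => //; first exact: (integrableS measurableT).
  move=> E EZ mE; rewrite integral0; apply/eqP; rewrite eq_le g_ge0// andbT.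
  rewrite -oppe_ge0 -integralN; last first.
    exact/integrable_add_def/(integrableS measurableT).
  by apply: integral_ge0 => x /EZ; rewrite /Z/= in_itv/= oppe_ge0 => /ltW.
apply: ae_mp => x gx; rewrite leNgt; apply/negP => gx0.
by have := gx; rewrite /Z/= in_itv/= => /(_ gx0) gx'; rewrite gx' ltxx in gx0.
Qed.

Section Sinfty_criterion.
Context {R : realType} {X K : pmetricType R}.
Local Notation Sigma := (borel X * borel K)%type.
Context (m : probability (borel X) R) (mu0 : probability Sigma R).
Context (nu0 : {finite_measure set Sigma -> \bar R}).
Context (kappa : X -> probability Sigma R) (rho : X -> R).
Hypothesis nu0E : forall E, measurable E -> nu0 E = mu0 E.
Hypothesis kappaP : is_disintegration m nu0 kappa.
Hypothesis mrho : measurable_fun [set: borel X] rho.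
Hypothesis rho_ge0 : forall x, 0 <= rho x.
Hypothesis rhoE :
  {ae m, forall x, base_density m (charge_of_finite_measure nu0) x = (rho x)%:E}.
Context (f : X * K -> R) (M : R).
Hypothesis mf : measurable_fun [set: Sigma] f.
Hypothesis fM : forall u, `|f u| <= M.
Hypothesis intf : mu0.-integrable [set: Sigma] (EFin \o f).

Let part_disintegration (nu : {finite_measure set Sigma -> \bar R}) (g : X * K -> R) :
  measurable_fun [set: Sigma] g -> (forall u, 0 <= g u <= M) ->
  (forall E, measurable E -> nu E = \int[mu0]_(u in E) (g u)%:E)%E ->
  exists kappa', is_disintegration m nu kappa'.
Proof.
move=> mg gM nuE.
apply: (@disintegration_density _ _ _ _ nu0 nu kappa rho g M) => //.
- by move=> u; case/andP: (gM u).
- by move=> u; case/andP: (gM u).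
- move=> E mE; rewrite nuE//; apply: eq_measure_integral => D mD _.
  exact/esym/nu0E.
Qed.

(** [psip] and [psin] are the base densities of the Jordan parts of [f mu0];
    they bound the mass of the leaf restrictions, and their difference is the
    base density of [f mu0]. *)
Lemma Sinfty_induced_charge (psip psin : X -> R) (c : R) :
  lipschitz_fun psip -> lipschitz_fun psin ->
  (forall x, 0 <= psip x <= c) -> (forall x, 0 <= psin x <= c) ->
  (forall C : set (borel X), measurable C ->
    \int[mu0]_(u in fst @^-1` C) (Num.max (f u) 0)%:E =
    \int[m]_(x in C) (psip x)%:E)%E ->
  (forall C : set (borel X), measurable C ->
    \int[mu0]_(u in fst @^-1` C) (Num.max (- f u) 0)%:E =
    \int[m]_(x in C) (psin x)%:E)%E ->
  Sinfty m (induced_charge intf).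
Proof.
move=> psipL psinL psip_c psin_c psipE psinE.
set nu := (induced_charge intf : {charge set Sigma -> \bar R}).
have mpsip := lipschitz_fun_measurable psipL.
have mpsin := lipschitz_fun_measurable psinL.
have bounded_integrable (psi : X -> R) : measurable_fun [set: borel X] psi ->
    (forall x, 0 <= psi x <= c) -> m.-integrable [set: borel X] (EFin \o psi).
  move=> mpsi psic; apply: measurable_bounded_integrable => //.
    by rewrite (le_lt_trans (probability_le1 m _))// ltry.
  exists c; split; first exact: num_real.
  move=> r cr x _; have /andP[p0 pc] := psic x.
  by rewrite /= ger0_norm// (le_trans pc)// ltW.
have intp := bounded_integrable _ mpsip psip_c.
have intn := bounded_integrable _ mpsin psin_c.
have posE (C : set (borel X)) : measurable C ->
    pos_part nu (fst @^-1` C) = (\int[m]_(x in C) (psip x)%:E)%E.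
  by move=> mC; rewrite pos_part_induced ?psipE//; exact: measurable_fiber.
have negE (C : set (borel X)) : measurable C ->
    neg_part nu (fst @^-1` C) = (\int[m]_(x in C) (psin x)%:E)%E.
  by move=> mC; rewrite neg_part_induced ?psinE//; exact: measurable_fiber.
have densp : {ae m, forall x, base_density m
    (charge_of_finite_measure (pos_part nu)) x = (psip x)%:E}.
  exact: (base_density_ae (mu := charge_of_finite_measure (pos_part nu)) intp posE).
have densn : {ae m, forall x, base_density m
    (charge_of_finite_measure (neg_part nu)) x = (psin x)%:E}.
  exact: (base_density_ae (mu := charge_of_finite_measure (neg_part nu)) intn negE).
have mfp : measurable_fun [set: Sigma] (fun u => Num.max (f u) 0).
  exact: measurable_maxr.
have mfn : measurable_fun [set: Sigma] (fun u => Num.max (- f u) 0).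
  by apply: measurable_maxr => //; exact: measurableT_comp.
have [kappap kappapP] : exists kappa', is_disintegration m (pos_part nu) kappa'.
  apply: (part_disintegration mfp) => [u|]; last exact: pos_part_induced.
  rewrite le_max lexx orbT ge_max/= (le_trans _ (fM u)) ?ler_norm//.
  exact: le_trans (fM u).
have [kappan kappanP] : exists kappa', is_disintegration m (neg_part nu) kappa'.
  apply: (part_disintegration mfn) => [u|]; last exact: neg_part_induced.
  rewrite le_max lexx orbT ge_max/= (le_trans _ (fM u)) ?(le_trans _ (fM u))//.
  by rewrite -normrN ler_norm.
split; [split|].
- split; first exact: (base_charge_dominates (mu := charge_of_finite_measure (pos_part nu)) intp posE).
  exact: (base_charge_dominates (mu := charge_of_finite_measure (neg_part nu)) intn negE).
- exists kappap, kappan; split => //.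
  apply: (@le_lt_trans _ _ (c *+ 4)%:E); last by rewrite ltry.
  apply/ess_supP; apply: ae_mp2 densp densn => x px nx.
  apply: W_norm_leaf_restriction; [rewrite px|rewrite nx]; rewrite lee_fin.
    by have /andP[? ?] := psip_c x; rewrite ger0_norm.
  by have /andP[? ?] := psin_c x; rewrite ger0_norm.
- exists (fun x => psip x - psin x).
    have [C1 _ L1] := lipschitz_fun_ge0 psipL.
    have [C2 _ L2] := lipschitz_fun_ge0 psinL.
    exists (C1 + C2) => x y.
    rewrite (_ : _ - _ = (psip x - psip y) - (psin x - psin y)); last by ring.
    rewrite (le_trans (ler_normB _ _))//; have := L1 x y; have := L2 x y.
    lra.
  apply: (@base_density_ae _ _ _ _ _ (fun x => (psip x)%:E - (psin x)%:E)%E).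
    exact: integrableB.
  move=> C mC.
  have mCf := measurable_fiber (K := K) mC.
  have := jordan_decomp (hahn_posnegP nu) mCf.
  rewrite integralB//; [|exact: (integrableS measurableT)..].
  rewrite -posE// -negE// => ->.
  by rewrite /cadd/= /cscale/= EFinN mulN1e.
Qed.

End Sinfty_criterion.

Theorem proposition8p3 (R : realType) (N : nat) (A : 'M[nat]_N)
    (theta : R) (hA : aperiodic A) (theta01 : 0 < theta < 1)
    (m : probability (borel (sft hA theta01)) R) (hm : markov_measure m)
    (K : pmetricType R) (hK : compact [set: K]) (hdiam : diam K = 1)
    (G : sft hA theta01 * K -> K)
    (hG : measurable_fun [set: borel (sft hA theta01) * borel K]
            (G : borel (sft hA theta01) * borel K -> borel K))
    (hi : exists2 alpha : R, 0 < alpha < 1 &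
      {ae m, forall x, forall y1 y2 : K,
         mdist (G (x, y1)) (G (x, y2)) <= alpha * mdist y1 y2})
    (hii : exists k : K -> R,
      [/\ forall y, 0 <= k y,
          has_ubound (range k) &
          forall (y : K) (x1 x2 : sft hA theta01),
            mdist (G (x1, y)) (G (x2, y)) <= k y * mdist x1 x2])
    (mu0 : probability (borel (sft hA theta01) * borel K)%type R)
    (hinv : forall E : set (borel (sft hA theta01) * borel K), measurable E ->
      mu0 (skew_product G @^-1` E) = mu0 E)
    (hmu0 : Sinfty m (charge_of_finite_measure mu0)) :
  forall f : sft hA theta01 * K -> R, lipschitz_sum f -> Theta m mu0 f.
Proof.
move: hm => [P [p [[P_ge0 P_sum1] P_gt0 [p_ge0 p_sum1] p_stat m_cyl]]].
have mP : markov_data m P p by split=> //; exact: m_cyl.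
have [alpha alpha01 contr] := hi.
have [k [k_ge0 [kmax kmaxP] kG]] := hii.
have k_le y : k y <= kmax by apply: kmaxP; exists y.
have kmax_ge0 : 0 <= kmax := le_trans (k_ge0 point) (k_le point).
have G_lip y x1 x2 : mdist (G (x1, y)) (G (x2, y)) <= kmax * mdist x1 x2.
  by rewrite (le_trans (kG _ _ _))// ler_wpM2r ?mdist_ge0.
have K_diam (y1 y2 : K) : mdist y1 y2 <= 1.
  by rewrite -hdiam mdist_le_diam// hdiam.
have cS := second_countable_sft hA theta01.
have cK := compact_second_countable hK.
have [[[dom _] [kappa [_ [kappaP _ _]]]] [g gL gE]] := hmu0.
set nu0 := pos_part (charge_of_finite_measure mu0) in dom kappaP.
have nu0E E : measurable E -> nu0 E = mu0 E by exact: pos_part_finite_measure.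
have mfiber (C : set (borel (sft hA theta01))) : measurable C ->
  measurable (fst @^-1` C : set (borel (sft hA theta01) * borel K)).
  exact: measurable_fiber.
have dom0 : base_charge (charge_of_finite_measure mu0) `<< m.
  apply/null_content_dominatesP => C mC mC0; move/null_content_dominatesP : dom.
  by move=> /(_ C mC mC0) <-; exact: esym (nu0E _ (mfiber C mC)).
have intd := Radon_Nikodym_integrable dom0.
have densE (C : set (borel (sft hA theta01))) : measurable C ->
    mu0 (fst @^-1` C) =
    (\int[m]_(x in C) base_density m (charge_of_finite_measure mu0) x)%E.
  by move=> mC; rewrite -Radon_Nikodym_integral.
have dens0E : {ae m, forall x, base_density m (charge_of_finite_measure nu0) x =
    base_density m (charge_of_finite_measure mu0) x}.
  apply: (base_density_ae (mu := charge_of_finite_measure nu0) intd) => C mC.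
  by rewrite -densE//; exact: (nu0E _ (mfiber C mC)).
have dens_ge0 : {ae m, forall x,
    (0 <= base_density m (charge_of_finite_measure mu0) x)%E}.
  by apply: (ae_ge0_density intd) => C mC; rewrite -densE.
(* the density is nonnegative almost everywhere; truncating makes it so
   everywhere and keeps it Lipschitz *)
pose rho x := Num.max (g x) 0.
have rho_ge0 x : 0 <= rho x by rewrite /rho le_max lexx orbT.
have rhoE : {ae m, forall x,
    base_density m (charge_of_finite_measure mu0) x = (rho x)%:E}.
  apply: ae_mp2 gE dens_ge0 => x ->; rewrite lee_fin => gx.
  by rewrite /rho max_l.
have rhoL : lipschitz_fun rho.
  have [C gC] := gL; exists C => x y.
  by rewrite (le_trans (ler_dist_max0 _ _)).
have marginal (C : set (borel (sft hA theta01))) : measurable C ->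
    mu0 (fst @^-1` C) = (\int[m]_(x in C) (rho x)%:E)%E.
  move=> mC; rewrite densE//; apply: ae_eq_integral => //.
  - exact: (measurable_funTS (measurable_base_density _ _)).
  - apply/measurable_EFinP; apply: measurable_funTS.
    exact: (lipschitz_fun_measurable (X := sft hA theta01)).
  - by apply: ae_mp rhoE => x ->.
move=> f fL; have [L fC] := fL.
have [L' L'0 fL'] : exists2 L', 0 <= L' & forall u v,
    `|f u - f v| <= L' * (mdist u.1 v.1 + mdist u.2 v.2).
  exists `|L| => // u v; rewrite (le_trans (fC u v))//.
  by rewrite ler_wpM2r ?addr_ge0 ?mdist_ge0// ler_norm.
have [M fM] : exists M, forall u, `|f u| <= M.
  exists (`|f point| + L' * ((1 - theta)^-1 + 1)) => u.
  rewrite -[f u](subrK (f point)) addrC (le_trans (ler_normD _ _))// lerD2l.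
  rewrite (le_trans (fL' _ _))// ler_wpM2l// lerD//.
  exact: mdist_sft_le.
have mf := lipschitz_sum_measurable (X := sft hA theta01) cS cK fL.
have intf : mu0.-integrable setT (EFin \o f).
  apply: measurable_bounded_integrable => //.
    by rewrite (le_lt_trans (probability_le1 mu0 _))// ltry.
  exists M; split; first exact: num_real.
  by move=> r Mr u _; rewrite /= (le_trans (fM u))// ltW.
exists intf.
have average (h : sft hA theta01 * K -> R) : (forall u, 0 <= h u <= M) ->
    (forall u v, `|h u - h v| <= `|f u - f v|) ->
    exists2 psi : sft hA theta01 -> R, lipschitz_fun psi /\ (forall x, 0 <= psi x) &
      forall C : set (borel (sft hA theta01)), measurable C ->
        (\int[mu0]_(u in fst @^-1` C) (h u)%:E = \int[m]_(x in C) (psi x)%:E)%E.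
  move=> hM hf.
  have [psi [psiL psi0 psiE]] := lipschitz_leafwise_average mP cK K_diam hG alpha01
    contr kmax_ge0 G_lip hinv rhoL rho_ge0 marginal
    (fun u => proj1 (andP (hM u))) (fun u => proj2 (andP (hM u))) L'0
    (fun u v => le_trans (hf u v) (fL' u v)).
  by exists psi.
have [psip [psipL psip0] psipE] : exists2 psi : sft hA theta01 -> R,
    lipschitz_fun psi /\ (forall x, 0 <= psi x) &
    forall C : set (borel (sft hA theta01)), measurable C ->
      (\int[mu0]_(u in fst @^-1` C) (Num.max (f u) 0)%:E =
       \int[m]_(x in C) (psi x)%:E)%E.
  apply: average => [u|u v]; last exact: ler_dist_max0.
  rewrite le_max lexx orbT ge_max/= (le_trans (ler_norm _) (fM u)).
  exact: le_trans (fM u).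
have [psin [psinL psin0] psinE] : exists2 psi : sft hA theta01 -> R,
    lipschitz_fun psi /\ (forall x, 0 <= psi x) &
    forall C : set (borel (sft hA theta01)), measurable C ->
      (\int[mu0]_(u in fst @^-1` C) (Num.max (- f u) 0)%:E =
       \int[m]_(x in C) (psi x)%:E)%E.
  apply: average => [u|u v].
    rewrite le_max lexx orbT ge_max/= (le_trans (ler_norm _)) ?normrN//.
    exact: le_trans (fM u).
  by rewrite (le_trans (ler_dist_max0 _ _))// -opprD normrN.
have [cp _ psip_c] := lipschitz_sft_bounded psipL.
have [cn _ psin_c] := lipschitz_sft_bounded psinL.
apply: (@Sinfty_induced_charge _ _ _ m mu0 nu0 kappa rho nu0E kappaP _ rho_ge0 _
  f M mf fM intf psip psin (Num.max cp cn)) => //.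
- exact: (lipschitz_fun_measurable (X := sft hA theta01)).
- by apply: ae_mp2 dens0E rhoE => x ->.
- move=> x; rewrite psip0 le_max -[psip x]ger0_norm// psip_c.
  by [].
- move=> x; rewrite psin0 le_max -[psin x]ger0_norm// psin_c orbT.
  by [].
Qed.
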